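(* Let $p\ge 3$ be a prime, let $\phi(x)=\frac{ax+b}{cx+d}$ with $a,b,c,d\in\mathbb{Q}_p$, $ad-bc\ne0$, let $\Delta=(d-a)^2+4bc$ with $\sqrt{\Delta}\notin\mathbb{Q}_p$, let $K=\mathbb{Q}_p(\sqrt\Delta)$ with uniformizer $\pi$, and suppose that $\lambda=\frac{a+d+\sqrt{\Delta}}{a+d-\sqrt{\Delta}}\in K$ is not a root of unity. Let $\ell$ be the order of (the reduction of) $\lambda$ in the multiplicative group of the residue field of $K$. Then the system $(\mathbb{P}^1(\mathbb{Q}_p),\phi)$ is minimal if and only if one of the following conditions is satisfied: (1) $\mathbb{Q}_p(\sqrt{\Delta})$ is an unramified quadratic extension of $\mathbb{Q}_p$, $\ell=p+1$ and $v_p(\lambda^{\ell}-1)=1$; (2) $\mathbb{Q}_p(\sqrt{\Delta})$ is a ramified quadratic extension of $\mathbb{Q}_p$ and $v_\pi(\lambda^{p}+1)=3$.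
   Context: $\mathbb{P}^1(\mathbb{Q}_p)=\mathbb{Q}_p\cup\{\infty\}$ with its usual compact topology. $|\cdot|_p$ and $v_p=-\log_p|\cdot|_p$ are extended to $K$; $v_\pi:=e\,v_p$ where $e$ is the ramification index of $K/\mathbb{Q}_p$ (so $v_\pi(\pi)=1$). One has $|\lambda|_p=1$. The system $(\mathbb{P}^1(\mathbb{Q}_p),\phi)$ is minimal if every orbit $\{\phi^n(x):n\ge0\}$, $x\in\mathbb{P}^1(\mathbb{Q}_p)$, is dense in $\mathbb{P}^1(\mathbb{Q}_p)$. *)

(* Defs.v *)
From HB Require Import structures.
From mathcomp Require Import all_boot all_order all_algebra all_field.
From mathcomp Require Import generic_quotient ring_quotient fraction.
From mathcomp Require Import all_classical all_reals all_analysis.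

Set Implicit Arguments.
Unset Strict Implicit.
Unset Printing Implicit Defensive.

Import Order.TTheory GRing.Theory Num.Theory.
Local Open Scope classical_set_scope.
Local Open Scope ring_scope.
Local Open Scope quotient_scope.

(* [Z_p] is the inverse limit of the rings [Z / p^n]; a class mod [p ^ n] is
   represented by its remainder, so [x n] is determined by [x n.+1], and
   [x 0 = 0]. *)
Record padic_int (p : nat) (hp : prime p) := PadicInt {
  padic_res :> nat -> int;
  padic_coh : `[< forall n, padic_res n = (padic_res n.+1 %% p%:Z ^+ n)%Z >] }.

Section PadicIntRing.
Context (p : nat) (hp : prime p).
Local Notation Zp := (padic_int hp).
Local Notation q n := (p%:Z ^+ n).
Implicit Types x y z : Zp.

HB.instance Definition _ := [isSub of Zp for @padic_res p hp].
HB.instance Definition _ := [Choice of Zp by <:].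

Let q_neq0 n : q n != 0 :> int.
Proof. by rewrite expf_neq0// eqz_nat -lt0n prime_gt0. Qed.

Lemma padic_resS x n : (x n.+1 %% q n)%Z = x n.
Proof. by rewrite -(asboolW (padic_coh x)). Qed.

Lemma padic_res_mod x n : (x n %% q n)%Z = x n.
Proof. by rewrite -padic_resS modz_mod. Qed.

Lemma padic_resD x n k : (x (k + n)%N %% q n)%Z = x n.
Proof.
elim: k => [|k IH]; first exact: padic_res_mod.
rewrite -{}[RHS]IH -(padic_resS x (k + n)) addSn.
apply/eqP; rewrite eqz_mod_dvd; apply: (@dvdz_trans (q (k + n))).
  exact/dvdz_exp2l/leq_addl.
by rewrite -eqz_mod_dvd modz_mod.
Qed.

Lemma padic_eqP x y : (forall n, x n = y n %[mod q n])%Z -> x = y.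
Proof.
move=> xy; apply: val_inj; apply/funext => n /=.
by have := xy n; rewrite !padic_res_mod.
Qed.

Fact padic_of_coh (f : nat -> int) : (forall n, f n.+1 = f n %[mod q n])%Z ->
  `[< forall n, (f n %% q n)%Z = ((f n.+1 %% q n.+1)%Z %% q n)%Z >].
Proof.
move=> fP; apply/asboolP => n; rewrite -fP; apply/eqP.
rewrite eqz_mod_dvd (@dvdz_trans (q n.+1))//; first exact: dvdz_exp2l.
by rewrite -eqz_mod_dvd modz_mod.
Qed.

Definition padic_of (f : nat -> int)
    (fP : forall n, (f n.+1 = f n %[mod q n])%Z) : Zp :=
  PadicInt hp (padic_of_coh fP).

Let resS x n : (x n.+1 = x n %[mod q n])%Z.
Proof. by rewrite -[x n]padic_resS modz_mod. Qed.

Fact padic_const_subproof (c : int) n : (c = c %[mod q n])%Z. Proof. by []. Qed.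
Fact padic_opp_subproof x n : (- x n.+1 = - x n %[mod q n])%Z.
Proof. by rewrite -modzNm resS modzNm. Qed.
Fact padic_add_subproof x y n :
  (x n.+1 + y n.+1 = x n + y n %[mod q n])%Z.
Proof. by rewrite -modzDm !resS modzDm. Qed.
Fact padic_mul_subproof x y n :
  (x n.+1 * y n.+1 = x n * y n %[mod q n])%Z.
Proof. by rewrite -modzMm !resS modzMm. Qed.

Definition padic_const (c : int) : Zp := padic_of (padic_const_subproof c).
Definition padic_opp x : Zp := padic_of (padic_opp_subproof x).
Definition padic_add x y : Zp := padic_of (padic_add_subproof x y).
Definition padic_mul x y : Zp := padic_of (padic_mul_subproof x y).

Fact padic_addA : associative padic_add.
Proof.
by move=> x y z; apply: padic_eqP => n; rewrite /= !modz_mod modzDml modzDmr addrA.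
Qed.
Fact padic_addC : commutative padic_add.
Proof. by move=> x y; apply: padic_eqP => n; rewrite /= addrC. Qed.
Fact padic_add0 : left_id (padic_const 0) padic_add.
Proof. by move=> x; apply: padic_eqP => n; rewrite /= modz_mod modzDml add0r. Qed.
Fact padic_addN : left_inverse (padic_const 0) padic_opp padic_add.
Proof. by move=> x; apply: padic_eqP => n; rewrite /= !modz_mod modzDml addNr. Qed.
HB.instance Definition _ := GRing.isZmodule.Build Zp
  padic_addA padic_addC padic_add0 padic_addN.

Fact padic_mulA : associative padic_mul.
Proof.
by move=> x y z; apply: padic_eqP => n; rewrite /= !modz_mod modzMml modzMmr mulrA.
Qed.
Fact padic_mulC : commutative padic_mul.
Proof. by move=> x y; apply: padic_eqP => n; rewrite /= mulrC. Qed.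
Fact padic_mul1 : left_id (padic_const 1) padic_mul.
Proof. by move=> x; apply: padic_eqP => n; rewrite /= modz_mod modzMml mul1r. Qed.
Fact padic_mulDl : left_distributive padic_mul padic_add.
Proof.
by move=> x y z; apply: padic_eqP => n; rewrite /= !modz_mod modzMml modzDm mulrDl.
Qed.
Fact padic_oner_neq0 : padic_const 1 != 0.
Proof.
apply/eqP => /(congr1 (fun x : Zp => x 1%N)) /=.
by rewrite expr1 mod0z modz_small// ltz_nat prime_gt1.
Qed.
HB.instance Definition _ := GRing.Zmodule_isComNzRing.Build Zp
  padic_mulA padic_mulC padic_mul1 padic_mulDl padic_oner_neq0.

Lemma padic_res0 n : (0 : Zp) n = 0. Proof. exact: mod0z. Qed.
Lemma padic_res_at0 x : x 0%N = 0.
Proof. by rewrite -padic_res_mod expr0 modz1. Qed.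

Lemma padic_dvd x n k : (q n %| x (k + n)%N)%Z = (x n == 0).
Proof.
by apply/dvdz_mod0P/eqP; rewrite padic_resD.
Qed.

Lemma padic_neq0P x : x != 0 -> exists n, x n.+1 != 0.
Proof.
apply: contra_neqP => /forallNP x0; apply: padic_eqP => -[|n].
  by rewrite !padic_res_at0.
by rewrite padic_res0; have /negP := x0 n; rewrite negbK => /eqP ->.
Qed.

(* the exponent of [p] in [x]; the value at [0] is a dummy *)
Definition padic_ord x : nat :=
  if pselect (exists n, x n.+1 != 0) is left h then ex_minn h else 0%N.

Lemma padic_res_eq0 x n : x != 0 -> (x n == 0) = (n <= padic_ord x)%N.
Proof.
move=> x0; rewrite /padic_ord.
case: pselect => [h|]; last by move/(_ (padic_neq0P x0)).
case: ex_minnP => m xm0 mmin; apply/idP/idP => [xn0|nm].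
  rewrite leqNgt; apply/negP => mn; move/negP: xm0; apply.
  rewrite -(padic_dvd x m.+1 (n - m.+1)) subnK//.
  by rewrite (eqP xn0) dvdz0.
case: n nm => [|n] nm; first by rewrite padic_res_at0.
apply: contraLR nm => /mmin; by rewrite -leqNgt.
Qed.

Lemma padic_logn x n : x != 0 -> (padic_ord x < n)%N ->
  (x n != 0) /\ logn p `|x n|%N = padic_ord x.
Proof.
move=> x0 xn; have xn0 : x n != 0 by rewrite padic_res_eq0// -ltnNge.
split=> //.
have d k : (k <= n)%N -> (p ^ k %| `|x n|)%N = (k <= padic_ord x)%N.
  move=> kn; rewrite -padic_res_eq0// -(padic_dvd x k (n - k)) subnK//.
  by rewrite dvdzE abszX.
apply/eqP; rewrite eqn_leq; apply/andP; split.
  rewrite leqNgt -pfactor_dvdn// ?absz_gt0//.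
  by rewrite d// ltnn.
by rewrite -pfactor_dvdn ?absz_gt0// d// ltnW.
Qed.

Lemma padic_mul_neq0 x y : x != 0 -> y != 0 ->
  x * y != 0 /\ padic_ord (x * y) = (padic_ord x + padic_ord y)%N.
Proof.
move=> x0 y0; set m := padic_ord x; set n := padic_ord y.
have mulE k : (x * y) k = ((x k * y k) %% q k)%Z by [].
have H k : (m + n < k)%N -> forall j, (j <= k)%N ->
    (q j %| x k * y k)%Z = (j <= m + n)%N.
  move=> mnk j jk.
  have [xk lx] := padic_logn x0 (leq_ltn_trans (leq_addr n m) mnk).
  have [yk ly] := padic_logn y0 (leq_ltn_trans (leq_addl m n) mnk).
  rewrite dvdzE abszX abszM pfactor_dvdn ?muln_gt0 ?absz_gt0 ?xk ?yk//.
  by rewrite lognM ?absz_gt0// lx ly.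
have E k : ((x * y) k == 0) = (k <= m + n)%N.
  have [kmn|kmn] := leqP k (m + n).
    have := H _ (leqnn _) k (leqW kmn).
    rewrite kmn => d.
    have -> : (x * y) k = ((x * y) ((m + n).+1 - k + k)%N %% q k)%Z.
      by rewrite padic_resD.
    rewrite subnK ?leqW// mulE.
    apply/eqP/dvdz_mod0P/dvdz_mod0P.
    rewrite -[RHS](_ : (x (m + n).+1 * y (m + n).+1 %% q k)%Z = 0); last exact/dvdz_mod0P.
    apply/eqP; rewrite eqz_mod_dvd (@dvdz_trans (q (m + n).+1))//.
      by apply: dvdz_exp2l; exact: leqW.
    by rewrite -eqz_mod_dvd modz_mod.
  rewrite mulE; apply/negbTE/negP => /eqP /dvdz_mod0P.
  by rewrite H// leqNgt kmn.
have xy0 : x * y != 0.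
  by apply/eqP => xy0; have := E (m + n).+1; rewrite xy0 padic_res0 eqxx ltnn.
split=> //; apply/eqP; rewrite eqn_leq -E (padic_res_eq0 _ xy0) leqnn/=.
by rewrite -(padic_res_eq0 _ xy0) E.
Qed.

(* [Z_p] is given the (classically definable) unit-ring structure needed to
   form its field of fractions *)
Definition padic_unit : {pred Zp} := [pred x | `[< exists y, y * x = 1 >]].
Definition padic_inv x : Zp :=
  if pselect (exists y, y * x = 1) is left h then projT1 (cid h) else x.
Fact padic_mulVx : {in padic_unit, left_inverse 1 padic_inv *%R}.
Proof.
move=> x /asboolP xu; rewrite /padic_inv; case: pselect => // h.
by case: cid.
Qed.
Fact padic_unitPl x y : y * x = 1 -> padic_unit x.
Proof. by move=> yx; apply/asboolP; exists y. Qed.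
Fact padic_inv_out : {in [predC padic_unit], padic_inv =1 id}.
Proof.
by move=> x /asboolPn xu; rewrite /padic_inv; case: pselect.
Qed.
HB.instance Definition _ := GRing.ComNzRing_hasMulInverse.Build Zp
  padic_mulVx padic_unitPl padic_inv_out.

Fact padic_idomain : GRing.integral_domain_axiom Zp.
Proof.
move=> x y xy; have [//|x0] := eqVneq x 0; have [//|y0] := eqVneq y 0.
by have [/eqP] := padic_mul_neq0 x0 y0.
Qed.
HB.instance Definition _ := GRing.ComUnitRing_isIntegral.Build Zp padic_idomain.

Definition padic_int_norm x : rat := if x == 0 then 0 else p%:R ^- padic_ord x.

End PadicIntRing.

Record absval (R : realFieldType) (K : fieldType) := AbsVal {
  absval_fun :> K -> R;
  absval_ge0 : forall x, 0 <= absval_fun x;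
  absval_eq0 : forall x, (absval_fun x == 0) = (x == 0);
  absvalM : {morph absval_fun : x y / x * y};
  absval_ultra : forall x y,
    absval_fun (x + y) <= Num.max (absval_fun x) (absval_fun y) }.

Section AbsvalTheory.
Context (R : realFieldType) (K : fieldType) (v : absval R K).

Lemma absval0 : v 0 = 0. Proof. by apply/eqP; rewrite absval_eq0. Qed.

Lemma absval1 : v 1 = 1.
Proof.
have v1 : v 1 != 0 by rewrite absval_eq0 oner_eq0.
by apply: (mulfI v1); rewrite -absvalM !mulr1.
Qed.

Lemma absvalN x : v (- x) = v x.
Proof.
suff vN1 : v (-1) = 1 by rewrite -mulN1r absvalM vN1 mul1r.
apply/eqP; rewrite -(@pexpr_eq1 _ _ 2)// ?absval_ge0//.
by rewrite expr2 -absvalM mulrNN mulr1 absval1.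
Qed.

Lemma absvalV x : v x^-1 = (v x)^-1.
Proof.
have [->|x0] := eqVneq x 0; first by rewrite !(invr0, absval0).
have vx : v x != 0 by rewrite absval_eq0.
by apply: (mulfI vx); rewrite -absvalM !divff// absval1.
Qed.

End AbsvalTheory.

Section ResidueField.
Context (R : realFieldType) (K : fieldType) (v : absval R K).

Definition valring_pred : {pred K} := [pred x | v x <= 1].

Fact valring_subring_closed : subring_closed valring_pred.
Proof.
split=> [|x y|x y]; rewrite !inE.
- by rewrite absval1.
- move=> x1 y1; rewrite (le_trans (absval_ultra _ _ _))// ge_max x1.
  by rewrite absvalN.
- by move=> x1 y1; rewrite absvalM mulr_ile1 ?absval_ge0.
Qed.
HB.instance Definition _ :=
  GRing.isSubringClosed.Build K valring_pred valring_subring_closed.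

Record valring := ValRing { valring_val :> K; _ : valring_val \in valring_pred }.
HB.instance Definition _ := [isSub for valring_val].
HB.instance Definition _ := [Choice of valring by <:].
HB.instance Definition _ := [SubChoice_isSubComNzRing of valring by <:].

Definition maxideal : {pred valring} := [pred x : valring | v (val x) < 1].

Fact maxideal_idealr_closed : idealr_closed maxideal.
Proof.
split=> [||a x y]; rewrite !inE.
- by rewrite rmorph0 absval0.
- by rewrite rmorph1 absval1 ltxx.
- move=> x1 y1; rewrite rmorphD rmorphM/=.
  rewrite (le_lt_trans (absval_ultra _ _ _))// gt_max y1 andbT absvalM.
  by rewrite (le_lt_trans _ x1)// ler_piMl ?absval_ge0//; exact: (valP a).
Qed.
HB.instance Definition _ := isIdealr.Build valring maxideal maxideal_idealr_closed.

Definition residue_field := {ideal_quot maxideal}.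
HB.instance Definition _ := GRing.ComNzRing.on residue_field.


Definition residue (x : K) : residue_field := \pi_residue_field (insubd (0 : valring) x).

Definition residue_inv (a : residue_field) : residue_field :=
  if a == 0 then 0 else residue (val (repr a))^-1.

Fact residue_mulVf (a : residue_field) : a != 0 -> residue_inv a * a = 1.
Proof.
rewrite /residue_inv => a0; rewrite (negbTE a0).
move: a0; rewrite -{1 3}[a]reprK; set x := repr a => x0.
have vx : v (val x) = 1.
  apply/eqP; rewrite eq_le -[v _ <= 1]/(val x \in valring_pred) (valP x)/=.
  rewrite leNgt; apply: contra x0 => vx.
  rewrite -[0 in X in _ == X](rmorph0 (\pi_residue_field : valring -> _)).
  by rewrite -Quotient.idealrBE subr0.
have vV : (val x)^-1 \in valring_pred by rewrite inE absvalV vx invr1.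
rewrite /residue -rmorphM -[RHS](rmorph1 (\pi_residue_field : valring -> _)).
congr \pi; apply: val_inj; rewrite rmorphM rmorph1 /= val_insubd vV mulVf//.
by rewrite -(absval_eq0 v) vx oner_eq0.
Qed.
Fact residue_inv0 : residue_inv 0 = 0.
Proof. by rewrite /residue_inv eqxx. Qed.
HB.instance Definition _ :=
  GRing.ComNzRing_isField.Build residue_field residue_mulVf residue_inv0.

End ResidueField.

Section PadicNorm.
Context (p : nat) (hp : prime p).
Local Notation Zp := (padic_int hp).
Local Notation norm := (@padic_int_norm p hp).
Implicit Types x y z : Zp.

Let pX_gt0 n : 0 < p%:R ^+ n :> rat.
Proof. by rewrite exprn_gt0// ltr0n prime_gt0. Qed.

Lemma padic_int_norm_eq0 x : (norm x == 0) = (x == 0).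
Proof.
rewrite /padic_int_norm; case: ifP => [_|_]; first by rewrite eqxx.
by rewrite invr_eq0 gt_eqF.
Qed.

Lemma padic_int_norm_ge0 x : 0 <= norm x.
Proof. by rewrite /padic_int_norm; case: ifP => // _; rewrite invr_ge0 ltW. Qed.

Lemma padic_int_normM : {morph norm : x y / x * y}.
Proof.
move=> x y; rewrite /padic_int_norm.
have [->|x0] := eqVneq x 0; first by rewrite mul0r eqxx mul0r.
have [->|y0] := eqVneq y 0; first by rewrite mulr0 eqxx mulr0.
by have [/negbTE -> ->] := padic_mul_neq0 x0 y0; rewrite exprD invfM.
Qed.

Lemma padic_int_norm_le x n : (norm x <= p%:R ^- n) = (x n == 0).
Proof.
rewrite /padic_int_norm; case: ifPn => [/eqP ->|x0].
  by rewrite padic_res0 eqxx invr_ge0 ltW.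
rewrite padic_res_eq0// lef_pV2 ?posrE//.
by rewrite ler_eXn2l// ltr1n prime_gt1.
Qed.

Lemma padic_int_norm_ultra x y : norm (x + y) <= Num.max (norm x) (norm y).
Proof.
wlog xy : x y / norm x <= norm y => [H|].
  have /orP[/H//|/H] := le_total (norm x) (norm y).
  by rewrite addrC maxC.
rewrite (max_idPr xy).
have [y0|y0] := eqVneq y 0.
  by move: xy; rewrite y0 addr0.
have yE : norm y = p%:R ^- padic_ord y by rewrite /padic_int_norm (negbTE y0).
rewrite yE padic_int_norm_le.
have : norm x <= p%:R ^- padic_ord y by rewrite -yE.
rewrite padic_int_norm_le => /eqP xn.
have : norm y <= p%:R ^- padic_ord y by rewrite -yE.
rewrite padic_int_norm_le => /eqP yn.
have -> : (x + y) (padic_ord y) =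
  ((x (padic_ord y) + y (padic_ord y))%R %% p%:Z ^+ padic_ord y)%Z by [].
by rewrite xn yn mod0z.
Qed.

Definition padic : Type := {fraction Zp}.
HB.instance Definition _ := GRing.Field.on padic.

Local Notation num r := (frac r).1.
Local Notation den r := (frac r).2.

Definition padic_norm (a : padic) : rat :=
  norm (num (repr (a : {fraction Zp}))) / norm (den (repr (a : {fraction Zp}))).

Local Notation F := (@FracField.tofrac Zp).

Lemma padic_fracE (r : {ratio Zp}) : \pi_{fraction Zp} r = F (num r) / F (den r).
Proof.
apply: (canRL (mulfK _)); first by rewrite tofrac_eq0 denom_ratioP.
have E : FracField.mulf r (Ratio (den r) 1) = Ratio (num r * den r) (den r).
  by rewrite /FracField.mulf !numden_Ratio ?oner_eq0 ?denom_ratioP// mulr1.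
unlock FracField.tofrac; rewrite -[LHS]FracField.pi_mul E.
apply/eqmodP; rewrite /= FracField.equivfE !numden_Ratio ?oner_eq0 ?denom_ratioP//.
by rewrite mulr1 mulrC.
Qed.

Lemma padic_repr (a : padic) : exists n d, d != 0 /\ a = F n / F d.
Proof.
exists (num (repr (a : {fraction Zp}))), (den (repr (a : {fraction Zp}))).
by rewrite -padic_fracE reprK; split=> //; exact: denom_ratioP.
Qed.

Lemma padic_normE x y : y != 0 -> padic_norm (F x / F y) = norm x / norm y.
Proof.
move=> y0; rewrite /padic_norm; set r := repr _.
have d0 : den r != 0 by exact: denom_ratioP.
have : F x / F y = F (num r) / F (den r) by rewrite -padic_fracE /r reprK.
move/eqP; rewrite eqr_div ?tofrac_eq0// -!tofracM tofrac_eq => /eqP.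
move/(congr1 norm); rewrite !padic_int_normM => E.
by apply/eqP; rewrite eqr_div ?padic_int_norm_eq0// -E.
Qed.

Fact padic_norm_ge0 (a : padic) : 0 <= padic_norm a.
Proof. by rewrite divr_ge0 ?padic_int_norm_ge0. Qed.

Fact padic_norm_eq0 (a : padic) : (padic_norm a == 0) = (a == 0).
Proof.
have [x [y [y0 ->]]] := padic_repr a; rewrite padic_normE//.
rewrite !mulf_eq0 !invr_eq0 !padic_int_norm_eq0 !tofrac_eq0.
by rewrite (negbTE y0).
Qed.

Fact padic_normM : {morph padic_norm : a b / a * b}.
Proof.
move=> a b; have [x [y [y0 ->]]] := padic_repr a.
have [z [t [t0 ->]]] := padic_repr b.
rewrite mulf_div -!tofracM !padic_normE ?mulf_neq0//.
by rewrite !padic_int_normM mulf_div.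
Qed.

Fact padic_norm_ultra (a b : padic) :
  padic_norm (a + b) <= Num.max (padic_norm a) (padic_norm b).
Proof.
have [x [y [y0 ->]]] := padic_repr a.
have [z [t [t0 ->]]] := padic_repr b.
rewrite addf_div ?tofrac_eq0// -!tofracM -tofracD !padic_normE ?mulf_neq0//.
have ny : norm y != 0 by rewrite padic_int_norm_eq0.
have nt : norm t != 0 by rewrite padic_int_norm_eq0.
have yt : 0 < norm (y * t).
  by rewrite lt_def padic_int_norm_ge0 padic_int_norm_eq0 mulf_neq0.
rewrite -(mulfK nt (norm x)) -(mulfK ny (norm z)) -!mulrA -!invfM.
rewrite !mulrA -!padic_int_normM [t * y]mulrC -maxr_pMl ?invr_ge0 ?(ltW yt)//.
by rewrite ler_pM2r ?invr_gt0// padic_int_norm_ultra.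
Qed.

Definition padic_absval : absval rat padic :=
  AbsVal padic_norm_ge0 padic_norm_eq0 padic_normM padic_norm_ultra.

Let dist (a b : padic) : rat := padic_absval (a - b).
Fact padic_distxx a : dist a a = 0. Proof. by rewrite /dist subrr absval0. Qed.
Fact padic_dist_eq a b : dist a b = 0 -> a = b.
Proof. by move/eqP; rewrite absval_eq0 subr_eq0 => /eqP. Qed.
Fact padic_dist_sym a b : dist a b = dist b a.
Proof. by rewrite /dist -opprB absvalN. Qed.
Fact padic_dist_triangle b a c : dist a c <= dist a b + dist b c.
Proof.
rewrite /dist -(subrKA b) (le_trans (absval_ultra _ _ _))//.
by rewrite ge_max lerDl lerDr !absval_ge0.
Qed.
HB.instance Definition _ := isMetric.Build rat padic
  padic_distxx padic_dist_eq padic_dist_sym padic_dist_triangle.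

End PadicNorm.

(* the one-point compactification carries the usual topology of the projective
   line since [Q_p] is locally compact; [None] is the point at infinity *)
Definition padic_P1 (p : nat) (hp : prime p) : Type :=
  one_point_compactification (padic hp).
HB.instance Definition _ p hp := Topological.on (@padic_P1 p hp).

Definition homography (p : nat) (hp : prime p) (a b c d : padic hp)
    (x : padic_P1 hp) : padic_P1 hp :=
  match x with
  | Some x => if c * x + d == 0 then None else Some ((a * x + b) / (c * x + d))
  | None => if c == 0 then None else Some (a / c)
  end.

Definition minimal (T : topologicalType) (f : T -> T) : Prop :=
  forall x, dense (range (fun n => iter n f x)).

Section Extension.
Context (R : realType) (p : nat) (hp : prime p) (K : fieldExtType (padic hp)).
Implicit Types v : absval R K.

(* an extension of the absolute value of [Q_p] to a finite extension [K]
   exists and is unique, so quantifying over all [v] with [extends_padic v] is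
   the same as naming the extension; [padic_absval] is rational-valued, whence
   [ratr] *)
Definition extends_padic v : Prop :=
  forall x : padic hp, v x%:A = ratr (padic_absval hp x).

(* a generator of the maximal ideal of the valuation ring *)
Definition uniformizer v (pi : K) : Prop :=
  0 < v pi < 1 /\ forall x, v x < 1 -> v x <= v pi.

(* the ideal generated by [p] is the [e]-th power of the one generated by
   [pi] *)
Definition ramification_index v (pi : K) (e : nat) : Prop :=
  v p%:R = v (pi ^+ e).

(* [- log_p |x|]; the value at [x = 0] is a dummy *)
Definition vp v (x : K) : R := - (ln (v x) / ln p%:R).

Definition vpi v (e : nat) (x : K) : R := e%:R * vp v x.

Definition unramified_quadratic (e : nat) : Prop :=
  \dim (fullv : {vspace K}) = 2%N /\ e = 1%N.

Definition ramified_quadratic (e : nat) : Prop :=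
  \dim (fullv : {vspace K}) = 2%N /\ (1 < e)%N.

End Extension.

Arguments unramified_quadratic {p hp} K e.
Arguments ramified_quadratic {p hp} K e.

(* Main.v *)
(* Let s be a square root of Delta. The coordinate
     g(x) = (X + s) / (X - s),   X = 2 c x + d - a,
   sends infinity to 1 and the fixed points of phi to 0 and infinity, and it
   conjugates phi to multiplication by lambda on the group T of all quotients
   (x + y s) / (x - y s) with x, y in Q_p. Since g is a homeomorphism onto T,
   minimality says that the powers of lambda are dense in T.
   As p is odd, |x + s| = max(|x|, |s|), so that the distances to 1 in T that
   are smaller than 1 are the numbers r / p^k, where r is the absolute value of
   a uniformizer of K. Two elements of T at the same such distance from 1 differ,
   to first order, by an exponent in {0, ..., p-1}. Hence density amounts to:
   the powers of lambda meet every residue class of T, some power mu has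
   |mu - 1| = r, and |mu^p - 1| = r / p.
   In the unramified case T has p + 1 residue classes, and the last condition is
   automatic; in the ramified case the classes are those of 1 and -1, and one
   takes mu = lambda^2. *)
Require Import Defs.
From mathcomp Require Import all_boot all_order all_algebra all_field.
From mathcomp Require Import generic_quotient ring_quotient fraction.
From mathcomp Require Import all_classical all_reals all_analysis.
From mathcomp Require Import ring zify.

Set Implicit Arguments.
Unset Strict Implicit.
Unset Printing Implicit Defensive.

Import Order.TTheory GRing.Theory Num.Theory.
Local Open Scope ring_scope.

(** * Arithmetic of Z_p and Q_p: units, powers of [p], square roots *)

Section PadicFacts.
Context (p : nat) (hp : prime p).
Local Notation Zp := (padic_int hp).
Local Notation Qp := (padic hp).
Local Notation A := (padic_absval hp).
Local Notation norm := (@padic_int_norm p hp).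
Local Notation F := (@FracField.tofrac Zp).
Local Notation q n := (p%:Z ^+ n).
Implicit Types x y z : Zp.

Let q_neq0 n : q n != 0 :> int.
Proof. by rewrite expf_neq0// eqz_nat -lt0n prime_gt0. Qed.

Lemma padic_res_nat (n k : nat) : (n%:R : Zp) k = (n%:Z %% q k)%Z.
Proof.
elim: n => [|n IH]; first by rewrite padic_res0 mod0z.
rewrite -addn1 natrD PoszD.
have -> : (n%:R + 1 : Zp) k = (((n%:R : Zp) k + (1 %% q k)%Z) %% q k)%Z by [].
by rewrite IH modzDml modzDmr.
Qed.

Lemma padic_res_cong x n : (x n.+1 = x n %[mod q n])%Z.
Proof. by rewrite padic_resS padic_res_mod. Qed.

(** The quotient has residues [x (n + k) / p ^ k]; the shift by [k] makes up for the precision lost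
    in the division. *)
Lemma padic_int_divX x k : x k = 0 -> exists y, x = y * p%:R ^+ k.
Proof.
move=> xk.
have dv n : (q k %| x (n + k)%N)%Z by rewrite padic_dvd xk.
have H n : ((x (n.+1 + k)%N %/ q k)%Z = (x (n + k)%N %/ q k)%Z %[mod q n])%Z.
  apply/eqP; rewrite eqz_mod_dvd.
  rewrite -(dvdz_mul2r (q_neq0 k)).
  rewrite mulrBl !divzK ?dv// -exprD -eqz_mod_dvd; apply/eqP.
  by rewrite addSn; exact: padic_res_cong.
exists (padic_of hp H); apply: padic_eqP => n.
rewrite -natrX.
have -> : (padic_of hp H * (p ^ k)%N%:R) n =
  (((x (n + k)%N %/ q k)%Z %% q n)%Z * ((p ^ k)%N%:R : Zp) n %% q n)%Z by [].
rewrite padic_res_nat modz_mod modzMml modzMmr.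
have -> : ((p ^ k)%N)%:Z = q k by rewrite -natz natrX natz.
rewrite divzK ?dv// addnC padic_resD padic_res_mod.
by [].
Qed.

(** Each [x n] is invertible modulo [p ^ n] by Bézout. Inverses chosen independently are coherent
    because an inverse modulo [p ^ n] is unique. *)
Lemma padic_int_unit x : x 1%N != 0 -> exists y, x * y = 1.
Proof.
move=> x1.
have cop n : coprimez (x n) (q n).
  case: n => [|n]; first by rewrite expr0 coprimezE coprimen1.
  rewrite coprimezE abszX coprimeXr// coprime_sym prime_coprime//.
  apply: contra x1 => d.
  rewrite -(padic_dvd x 1 n) addn1 expr1 in d *.
  by rewrite dvdzE.
have /choice[f fE] : forall n, exists u, (x n * u = 1 %[mod q n])%Z.
  move=> n; have /coprimezP[[u w] /= uw] := cop n.
  by exists u; rewrite -uw mulrC addrC modzMDl.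
have H n : (f n.+1 = f n %[mod q n])%Z.
  apply/eqP; rewrite eqz_mod_dvd.
  rewrite -(@Gauss_dvdzr _ (x n)); last by rewrite coprimez_sym cop.
  rewrite mulrBr -eqz_mod_dvd fE -modzMml -padic_res_cong modzMml; apply/eqP.
  apply/eqP; rewrite eqz_mod_dvd (@dvdz_trans (q n.+1)) ?dvdz_exp2l//.
  by rewrite -eqz_mod_dvd fE.
exists (padic_of hp H); apply: padic_eqP => n.
have -> : (x * padic_of hp H) n = ((x n * (f n %% q n)%Z) %% q n)%Z by [].
by rewrite modz_mod modzMmr fE (padic_res_nat 1) modz_mod.
Qed.

Lemma padic_res_mulX x k : (x * p%:R ^+ k) k = 0.
Proof.
rewrite -natrX.
have -> : (x * (p ^ k)%N%:R) k = (x k * ((p ^ k)%N%:R : Zp) k %% q k)%Z by [].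
by rewrite padic_res_nat -natz natrX natz modzz mulr0 mod0z.
Qed.

Lemma padic_int_decomp x : x != 0 ->
  exists k (u : Zp), u 1%N != 0 /\ x = u * p%:R ^+ k.
Proof.
move=> x0; exists (padic_ord x).
have [u xE] : exists y, x = y * p%:R ^+ padic_ord x.
  by apply: padic_int_divX; apply/eqP; rewrite padic_res_eq0.
exists u; split=> //; apply/negP => /eqP /padic_int_divX[z uz].
have := ltnn (padic_ord x); rewrite -(padic_res_eq0 _ x0).
by rewrite {1}xE uz expr1 -mulrA -exprS padic_res_mulX eqxx.
Qed.

Lemma padic_int_norm_unit x : x 1%N != 0 -> norm x = 1.
Proof.
move=> x1; have x0 : x != 0 by apply: contraNneq x1 => ->; rewrite padic_res0.
rewrite /padic_int_norm (negbTE x0).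
move: x1; rewrite padic_res_eq0// -leqNgt leqn0 => /eqP ->.
by rewrite expr0 invr1.
Qed.

Lemma padic_absval_tofrac x : A (F x) = norm x.
Proof.
have -> : F x = F x / F 1 by rewrite tofrac1 divr1.
rewrite [LHS]padic_normE ?oner_neq0// (padic_int_norm_unit (x := 1)) ?divr1//.
by rewrite (padic_res_nat 1) expr1 modz_small ?ltz_nat ?prime_gt1.
Qed.

Lemma padic_absval_prime : A p%:R = p%:R^-1.
Proof.
have -> : (p%:R : Qp) = F p%:R by rewrite rmorph_nat.
rewrite padic_absval_tofrac.
have p2 : (p%:R : Zp) 2 != 0.
  rewrite padic_res_nat modz_small ?ltz_nat ?prime_gt0//.
    by rewrite -lt0n prime_gt0.
  by rewrite lez_nat ltn_Pmulr ?prime_gt1 ?prime_gt0.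
have p1 : (p%:R : Zp) 1%N == 0 by rewrite padic_res_nat expr1 modzz.
have p0 : (p%:R : Zp) != 0 by apply: contraNneq p2 => ->; rewrite padic_res0.
rewrite padic_res_eq0// in p1; rewrite padic_res_eq0// -leqNgt in p2.
rewrite /padic_int_norm (negbTE p0).
by have -> : padic_ord (p%:R : Zp) = 1%N by apply/eqP; rewrite eqn_leq p1 p2.
Qed.

Lemma padic_decomp (a : Qp) : a != 0 ->
  exists k (u : Zp), u 1%N != 0 /\ a = F u * p%:R ^ k.
Proof.
have [n [d [d0 ->]]] := padic_repr a => a0.
have n0 : n != 0 by apply: contraNneq a0 => ->; rewrite tofrac0 mul0r.
have [i [x [x1 ->]]] := padic_int_decomp n0.
have [j [y [y1 ->]]] := padic_int_decomp d0.
have [z yz] := padic_int_unit y1.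
have z1 : z 1%N != 0.
  apply/negP => /eqP z0.
  have /(congr1 (fun x : Zp => x 1%N)) := yz.
  have -> : (y * z) 1%N = (y 1%N * z 1%N %% q 1)%Z by [].
  rewrite z0 mulr0 mod0z (padic_res_nat 1) expr1 modz_small ?ltz_nat ?prime_gt1//.
have xz1 : (x * z) 1%N != 0.
  have -> : (x * z) 1%N = (x 1%N * z 1%N %% q 1)%Z by [].
  apply/negP => /eqP /dvdz_mod0P; rewrite expr1 dvdzE abszM Euclid_dvdM//.
  rewrite -!dvdzE -[p%:Z]expr1 => /orP[]; apply/negP.
    by move: x1; rewrite -(padic_dvd x 1 0).
  by move: z1; rewrite -(padic_dvd z 1 0).
have p0 : (p%:R : Qp) != 0.
  by rewrite -(absval_eq0 A) padic_absval_prime invr_eq0 pnatr_eq0 -lt0n prime_gt0.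
exists (i%:Z - j%:Z), (x * z); split=> //.
have zE : F z = (F y)^-1.
  have Fy : F y != 0.
    by rewrite tofrac_eq0; apply: contraNneq y1 => ->; rewrite padic_res0.
  by apply: (mulfI Fy); rewrite -tofracM yz tofrac1 mulfV.
rewrite !tofracM zE !rmorphXn !rmorph_nat expfzDr// -exprnN.
by rewrite invfM -!mulrA; congr (_ * _); rewrite mulrCA; congr (_ * _); rewrite mulrC.
Qed.

Lemma padic_absvalE (a : Qp) : a != 0 -> exists k : int, A a = p%:R ^ k.
Proof.
move=> /padic_decomp[k [u [u1 ->]]]; exists (- k).
rewrite absvalM padic_absval_tofrac padic_int_norm_unit// mul1r.
have AX n : A (p%:R ^+ n) = p%:R ^- n.
  elim: n => [|n IH]; first by rewrite !expr0 absval1 invr1.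
  by rewrite !exprS absvalM IH padic_absval_prime invfM.
case: k => n; first by rewrite -exprnP AX exprnN.
by rewrite NegzE opprK -exprnN absvalV AX invrK exprnP.
Qed.

Lemma padic_absval_int (a : Qp) : A a <= 1 -> exists x, a = F x.
Proof.
have [->|a0] := eqVneq a 0; first by exists 0; rewrite tofrac0.
have [n [d [d0 aE]]] := padic_repr a.
have [k [u [u1 E]]] := padic_decomp a0.
rewrite {1}E absvalM padic_absval_tofrac padic_int_norm_unit// mul1r.
case: k E => m E; first by exists (u * p%:R ^+ m); rewrite E rmorphM rmorphXn rmorph_nat.
have -> : A (p%:R ^ Negz m) = p%:R ^+ m.+1.
  rewrite NegzE -exprnN absvalV.
  elim: (m.+1) => [|i IH]; first by rewrite !expr0 absval1 invr1.
  by rewrite !exprS absvalM padic_absval_prime invfM IH invrK.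
by rewrite leNgt exprn_egt1// ltr1n prime_gt1.
Qed.

(** The witness is the first residue of [a]: the classes of Q_p are represented by
    [0, ..., p - 1]. *)
Lemma padic_near_nat (a : Qp) : A a <= 1 ->
  exists2 n : nat, (n < p)%N & A (a - n%:R) < 1.
Proof.
move=> /padic_absval_int[x ->].
have pgt0 : (0 < p%:Z) by rewrite ltz_nat prime_gt0.
have xp : (x 1%N < p%:Z).
  by rewrite -padic_res_mod expr1 ltz_pmod.
have x_ge0 : 0 <= x 1%N.
  by rewrite -padic_res_mod expr1 modz_ge0// gt_eqF.
case E : (x 1%N) xp x_ge0 => [n|//] np _; exists n => //.
rewrite -(rmorph_nat F) -rmorphB padic_absval_tofrac.
apply: (@le_lt_trans _ _ (p%:R ^- 1)); last first.
  by rewrite expr1 invf_lt1 ?ltr1n ?prime_gt1// ltr0n prime_gt0.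
rewrite padic_int_norm_le.
have -> : (x - n%:R) 1%N = ((x 1%N + ((- ((n%:R : Zp) 1%N))%R %% q 1)%Z)%R %% q 1)%Z by [].
by rewrite modzDmr padic_res_nat E -modzDmr modzNm modzDmr subrr mod0z.
Qed.

(** Hensel's lemma by Newton iteration from 1. All approximate roots are 1 modulo [p], so division
    by [2 * f n] is replaced by multiplication by [h = (p + 1) / 2], an inverse of 2 modulo [p]. *)
Lemma padic_int_sqrt x : (2 < p)%N -> x 1%N = 1 -> exists y, y ^+ 2 = x.
Proof.
move=> p2 x1; pose h : int := (p.+1)./2.
have h2 : 2 * h = p%:Z + 1.
  have op : odd p by case: (even_prime hp) p2 => [->|].
  by rewrite /h; lia.
(* [f n] is a root modulo [p ^ (n + 1)], hence the residue [x m.+2] in the correction that yields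
   [f m.+1]. *)
pose f := fix f (n : nat) : int :=
  if n is m.+1 then f m - h * (f m ^+ 2 - x m.+2) else 1.
have fS n : f n.+1 = f n - h * (f n ^+ 2 - x n.+2) by [].
have fP n : (p%:Z %| f n - 1)%Z /\ (q n.+1 %| f n ^+ 2 - x n.+1)%Z.
  elim: n => [|n [IH1 IH2]]; first by rewrite [f 0%N]/= x1 expr1n subrr !dvdz0.
  have /dvdzP[w wE] : (q n.+1 %| f n ^+ 2 - x n.+2)%Z.
    by rewrite -eqz_mod_dvd padic_res_cong eqz_mod_dvd.
  have /dvdzP[t tE] := IH1.
  have fE : f n = t * p%:Z + 1 by rewrite -tE subrK.
  split.
    rewrite fS wE exprS.
    rewrite (_ : _ - 1 = p%:Z * (t - h * w * q n)); last by rewrite fE; ring.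
    exact: dvdz_mulr.
  rewrite fS wE.
  have -> : (f n - h * (w * q n.+1)) ^+ 2 - x n.+2 =
     w * q n.+1 - 2 * h * w * q n.+1 * f n + h ^+ 2 * w ^+ 2 * q n.+1 ^+ 2.
    have -> : x n.+2 = f n ^+ 2 - w * q n.+1 by rewrite -wE; ring.
    ring.
  rewrite h2 fE.
  set Q := q n.+1; have -> : q n.+2 = Q * p%:Z by rewrite exprSr.
  (* The linear term gains a factor [p] because [2 * h * f n] is 1 modulo [p], the quadratic one
     because [Q] is itself a multiple of [p]. *)
  rewrite (_ : _ + _ = Q * p%:Z * (w * (- 1 - t * p%:Z - t) + h ^+ 2 * w ^+ 2 * q n)).
    exact: dvdz_mulr.
  by rewrite /Q exprS; ring.
have H n : (f n.+1 = f n %[mod q n])%Z.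
  apply/eqP; rewrite eqz_mod_dvd fS addrAC subrr add0r dvdzE abszN -dvdzE.
  apply: dvdz_mull; apply: (@dvdz_trans (q n.+1)); first exact: dvdz_exp2l.
  by rewrite -eqz_mod_dvd padic_res_cong eqz_mod_dvd; have [] := fP n.
exists (padic_of hp H); apply: padic_eqP => n.
have -> : (padic_of hp H ^+ 2) n = ((f n %% q n)%Z * (f n %% q n)%Z %% q n)%Z by [].
rewrite modzMml modzMmr modz_mod -expr2; apply/eqP.
rewrite -(padic_res_cong x) eqz_mod_dvd (@dvdz_trans (q n.+1))//.
  exact: dvdz_exp2l.
by have [] := fP n.
Qed.

Lemma padic_sqrt (a : Qp) : (2 < p)%N -> A (a - 1) < 1 -> exists b, b ^+ 2 = a.
Proof.
move=> p2 a1.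
have [y ay] : exists y, a = F y.
  apply: padic_absval_int; rewrite -[a](subrK 1).
  by rewrite (le_trans (absval_ultra _ _ _))// ge_max (ltW a1) absval1 lexx.
have y1 : y 1%N = 1.
  have : (y - 1) 1%N == 0.
    apply: contraTT a1 => y1; rewrite ay -(tofrac1 Zp) -rmorphB.
    by rewrite padic_absval_tofrac padic_int_norm_unit// ltxx.
  have -> : (y - 1) 1%N = ((y 1%N + ((- ((1%:R : Zp) 1%N))%R %% q 1)%Z)%R %% q 1)%Z by [].
  rewrite modzDmr padic_res_nat expr1 [(1 %% _)%Z]modz_small ?ltz_nat ?prime_gt1//.
  move=> /eqP /dvdz_mod0P; rewrite -eqz_mod_dvd => /eqP.
  rewrite -{1}[p%:Z]expr1 padic_res_mod modz_small ?ltz_nat ?prime_gt1//.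
have [z zE] := padic_int_sqrt p2 y1.
by exists (F z); rewrite ay -zE rmorphXn.
Qed.

End PadicFacts.

(** * Ultrametric estimates for powers *)

Section AbsvalEstimates.
Context (R : realFieldType) (K : fieldType) (v : absval R K).
Implicit Types x y : K.

Lemma absvalX x n : v (x ^+ n) = v x ^+ n.
Proof.
by elim: n => [|n IH]; rewrite ?expr0 ?absval1// !exprS absvalM IH.
Qed.

Lemma absval_gt0 x : (0 < v x) = (x != 0).
Proof. by rewrite lt_def absval_eq0 absval_ge0 andbT. Qed.

Lemma absvalXz x (n : int) : v (x ^ n) = v x ^ n.
Proof.
by case: n => n; rewrite ?NegzE -?exprnN ?absvalV absvalX ?exprnP.
Qed.

Lemma absvalD_le x y B : v x <= B -> v y <= B -> v (x + y) <= B.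
Proof. by move=> xB yB; rewrite (le_trans (absval_ultra _ _ _))// ge_max xB. Qed.

Lemma absvalD_lt x y B : v x < B -> v y < B -> v (x + y) < B.
Proof. by move=> xB yB; rewrite (le_lt_trans (absval_ultra _ _ _))// gt_max xB. Qed.

Lemma absvalB_le x y B : v x <= B -> v y <= B -> v (x - y) <= B.
Proof. by move=> xB yB; rewrite absvalD_le ?absvalN. Qed.

Lemma absvalB_lt x y B : v x < B -> v y < B -> v (x - y) < B.
Proof. by move=> xB yB; rewrite absvalD_lt ?absvalN. Qed.

Lemma absvalBC x y : v (x - y) = v (y - x).
Proof. by rewrite -absvalN opprB. Qed.

Lemma absvalDl x y : v y < v x -> v (x + y) = v x.
Proof.
move=> yx; apply/eqP; rewrite eq_le absvalD_le ?(ltW yx)//= leNgt.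
apply/negP => xy; have := absvalB_lt xy yx.
by rewrite addrK ltxx.
Qed.

Lemma absvalDr x y : v x < v y -> v (x + y) = v y.
Proof. by move=> xy; rewrite addrC absvalDl. Qed.

Lemma absval_near x y : v (x - y) < v y -> v x = v y.
Proof. by move=> xy; rewrite -[x](subrK y) absvalDr. Qed.

Lemma absval_nat_le1 n : v n%:R <= 1.
Proof.
elim: n => [|n IH]; first by rewrite absval0.
by rewrite -addn1 natrD absvalD_le// absval1.
Qed.

Lemma absval_sum_le (I : Type) (r : seq I) (P : pred I) (F : I -> K) B :
  0 <= B -> (forall i, P i -> v (F i) <= B) -> v (\sum_(i <- r | P i) F i) <= B.
Proof.
move=> B0 FB; elim/big_rec: _ => [|i x Pi xB]; first by rewrite absval0.
by rewrite absvalD_le ?FB.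
Qed.

Lemma absval_expB1_le x n : v x <= 1 -> v (x ^+ n - 1) <= v (x - 1).
Proof.
move=> x1; rewrite subrX1 absvalM ler_piMr ?absval_ge0//.
by apply: absval_sum_le => // i _; rewrite absvalX exprn_ile1 ?absval_ge0.
Qed.

Lemma absval_exp_first_order x n : v x <= 1 ->
  v ((1 + x) ^+ n - 1 - n%:R * x) <= v x ^+ 2.
Proof.
move=> x1; elim: n => [|n IH].
  by rewrite expr0 subrr mul0r subrr absval0 exprn_ge0 ?absval_ge0.
have -> : (1 + x) ^+ n.+1 - 1 - n.+1%:R * x =
    (1 + x) * ((1 + x) ^+ n - 1 - n%:R * x) + n%:R * x ^+ 2.
  by rewrite exprS -addn1 natrD; ring.
apply: absvalD_le.
  rewrite absvalM (le_trans _ IH)// ler_piMl ?absval_ge0//.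
  by rewrite absvalD_le ?absval1.
by rewrite absvalM absvalX ler_piMl ?exprn_ge0 ?absval_ge0 ?absval_nat_le1.
Qed.

Section ResidueChar.
Context (p : nat) (hp : prime p) (vp_lt1 : v p%:R < 1).

(** Bézout writes 1 as a combination of [n] and [p]; if both had absolute value below 1, so would
    1. *)
Lemma absval_nat_coprime n : ~~ (p %| n)%N -> v n%:R = 1.
Proof.
move=> pn; apply/eqP; rewrite eq_le absval_nat_le1 leNgt /=; apply/negP => n1.
have n0 : (0 < n)%N by case: n pn {n1} => //; rewrite dvdn0.
have [k1 k2 E _] := egcdnP p n0.
have : v ((k1 * n)%N%:R - (k2 * p)%N%:R) < 1.
  apply: absvalB_lt; rewrite natrM absvalM.
    by apply: le_lt_trans n1; rewrite ler_piMl ?absval_ge0 ?absval_nat_le1.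
  by apply: le_lt_trans vp_lt1; rewrite ler_piMl ?absval_ge0 ?absval_nat_le1.
have -> : (k1 * n)%N = (k2 * p + 1)%N.
  by rewrite E; congr (_ + _)%N; apply/eqP; rewrite gcdnC -/(coprime p n) prime_coprime.
by rewrite natrD [_ + 1]addrC addrK absval1 ltxx.
Qed.

(** The first-order term [j (x - 1)] has absolute value [v (x - 1)] and beats the error, which is at
    most the square of this. *)
Lemma absval_expB1_coprime x j : v (x - 1) < 1 -> ~~ (p %| j)%N ->
  v (x ^+ j - 1) = v (x - 1).
Proof.
move=> x1 pj; have [x0|xn1] := eqVneq (x - 1) 0.
  by move: x0 => /eqP; rewrite subr_eq0 => /eqP ->; rewrite expr1n.
have jx : v (j%:R * (x - 1)) = v (x - 1) by rewrite absvalM absval_nat_coprime ?mul1r.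
rewrite -jx; apply: absval_near; rewrite jx.
have := absval_exp_first_order j (ltW x1); rewrite [1 + _]addrC subrK.
move=> /le_lt_trans; apply.
by rewrite expr2 gtr_pMl// absval_gt0.
Qed.

(** The inner binomial coefficients are divisible by [p]; the terms of degree 1 and [p] are split
    off because they can be the leading ones. *)
Lemma absval_exp_prime x : v x <= 1 ->
  v ((1 + x) ^+ p - 1 - p%:R * x - x ^+ p) <= v p%:R * v x ^+ 2.
Proof.
move=> x1.
have p1 := prime_gt1 hp.
pose G i : K := (1 ^+ (p - i) * x ^+ i) *+ 'C(p, i).
have -> : (1 + x) ^+ p = \sum_(0 <= i < p.+1) G i by rewrite exprDn big_mkord.
rewrite big_nat_recr ?leq0n// (big_ltn (ltnW p1)) (big_ltn p1).
have -> : G 0%N = 1 by rewrite /G bin0 expr1n expr0 mulr1.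
have -> : G 1%N = p%:R * x by rewrite /G bin1 expr1n mul1r mulr_natl.
have -> : G p = x ^+ p by rewrite /G binn expr1n mul1r.
set S := \sum_(_ <= _ < _) _.
have -> : 1 + (p%:R * x + S) + x ^+ p - 1 - p%:R * x - x ^+ p = S by ring.
rewrite /S big_nat_cond; apply: absval_sum_le.
  by rewrite mulr_ge0 ?exprn_ge0 ?absval_ge0.
move=> i /andP[/andP[i2 ip] _]; rewrite /G expr1n mul1r -mulr_natl absvalM.
have /dvdnP[k ->] : (p %| 'C(p, i))%N by apply: prime_dvd_bin; rewrite // ip andbT ltnW.
apply: ler_pM; rewrite ?absval_ge0//.
  by rewrite natrM absvalM ler_piMl ?absval_ge0 ?absval_nat_le1.
by rewrite absvalX ler_wiXn2l ?absval_ge0.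
Qed.

(** As [p >= 3], the bound on the square makes [(x - 1) ^ p] no larger than [p (x - 1)]. The two
    have the same size when [p = 3] and [v (x - 1) ^ 2 = v p], and may then cancel; hence only an
    inequality, and a ramified criterion on [lambda ^ p]. *)
Lemma absval_exp_primeB1_le x : (2 < p)%N -> v (x - 1) <= 1 ->
  v (x - 1) ^+ 2 <= v p%:R ->
  v (x ^+ p - 1) <= v p%:R * v (x - 1).
Proof.
move=> p2; set y := x - 1 => y1 y2.
have -> : x = 1 + y by rewrite addrC subrK.
rewrite (_ : _ - 1 = ((1 + y) ^+ p - 1 - p%:R * y - y ^+ p) + p%:R * y + y ^+ p); last by ring.
have vp0 := absval_ge0 v p%:R; have vy0 := absval_ge0 v y.
apply: absvalD_le; last first.
  rewrite absvalX; apply: (@le_trans _ _ (v y ^+ 3)); first by rewrite ler_wiXn2l.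
  by rewrite exprSr ler_wpM2r.
apply: absvalD_le; last by rewrite absvalM.
apply: le_trans (absval_exp_prime y1) _.
by rewrite ler_wpM2l// expr2 ler_piMl.
Qed.

(** Closer to 1, and unless [x = 1], the term [p (x - 1)] strictly dominates all the others. *)
Lemma absval_exp_primeB1 x : (2 < p)%N -> v (x - 1) <= v p%:R ->
  v (x ^+ p - 1) = v p%:R * v (x - 1).
Proof.
move=> p2; have [->|xn1] := eqVneq x 1.
  by rewrite expr1n subrr absval0 mulr0.
set y := x - 1 => yp.
have y0 : 0 < v y by rewrite absval_gt0 subr_eq0.
have p0 : 0 < v p%:R by apply: lt_le_trans yp.
have -> : x = 1 + y by rewrite addrC subrK.
rewrite -absvalM; apply: absval_near.
rewrite (_ : _ - _ = ((1 + y) ^+ p - 1 - p%:R * y - y ^+ p) + y ^+ p); last by ring.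
have y1 : v y < 1 by apply: le_lt_trans vp_lt1.
have yy : v y * v y < v y by rewrite gtr_pMl.
apply: absvalD_lt; rewrite absvalM.
  apply: le_lt_trans (absval_exp_prime (ltW y1)) _.
  by rewrite ltr_pM2l// expr2.
rewrite absvalX; apply: (@le_lt_trans _ _ (v y ^+ 3)).
  by rewrite ler_wiXn2l// ltW.
rewrite exprS expr2; apply: (@le_lt_trans _ _ (v p%:R * (v y * v y))).
  by rewrite ler_pM2r// mulr_gt0.
by rewrite ltr_pM2l.
Qed.

End ResidueChar.

End AbsvalEstimates.

(** * Reduction to the residue field *)

Section ResidueTheory.
Context (R : realFieldType) (K : fieldType) (v : absval R K).
Implicit Types x y : K.

Lemma valring_predE x : (x \in valring_pred v) = (v x <= 1).
Proof. by rewrite inE. Qed.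

Lemma residue_eq x y : v x <= 1 -> v y <= 1 ->
  (residue v x == residue v y) = (v (x - y) < 1).
Proof.
move=> x1 y1; rewrite /residue -Quotient.idealrBE inE rmorphB /=.
by rewrite !val_insubd !valring_predE x1 y1.
Qed.

Lemma residue1 : residue v 1 = 1.
Proof.
rewrite /residue -[RHS](rmorph1 (\pi_(residue_field v)%qT : valring v -> _)).
congr (\pi_(residue_field v)%qT _); apply: val_inj.
by rewrite val_insubd valring_predE absval1 lexx rmorph1.
Qed.

Lemma residueM x y : v x <= 1 -> v y <= 1 ->
  residue v (x * y) = residue v x * residue v y.
Proof.
move=> x1 y1.
rewrite /residue -(rmorphM (\pi_(residue_field v)%qT : valring v -> _)).
congr (\pi_(residue_field v)%qT _); apply: val_inj.
rewrite rmorphM /= !val_insubd !valring_predE x1 y1 absvalM.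
by rewrite mulr_ile1 ?absval_ge0.
Qed.

Lemma residueX x n : v x <= 1 -> residue v (x ^+ n) = residue v x ^+ n.
Proof.
move=> x1; elim: n => [|n IH]; first by rewrite !expr0 residue1.
by rewrite !exprS residueM ?IH// absvalX exprn_ile1 ?absval_ge0.
Qed.

End ResidueTheory.

(** * The norm-one group of a quadratic extension *)

Section NormOneGroup.
Context (R : realFieldType) (p : nat) (hp : prime p) (p_gt2 : (2 < p)%N).
Context (Q K : fieldType) (io : {rmorphism Q -> K}) (v : absval R K).
Local Notation q := (v p%:R).
Hypothesis q01 : 0 < q < 1.
(** The facts about Q_p on which the group theory rests: its value group, its residue classes, and
    Hensel's lemma for squares. *)
Hypothesis io_val : forall x, x != 0 -> exists k : int, v (io x) = q ^ k.
Hypothesis io_near : forall x, v (io x) <= 1 ->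
  exists2 n : nat, (n < p)%N & v (io x - n%:R) < 1.
Hypothesis io_sqrt : forall x, v (io x - 1) < 1 -> exists y, y ^+ 2 = x.
Context (Delta : Q) (Delta_nsqr : ~ exists x, x ^+ 2 = Delta).
Context (s : K) (s2 : s ^+ 2 = io Delta).

Let q_gt0 : 0 < q. Proof. by case/andP: q01. Qed.
Let q_lt1 : q < 1. Proof. by case/andP: q01. Qed.

Lemma sqrt_neq0 : s != 0.
Proof.
apply/eqP => s0; apply: Delta_nsqr; exists 0; apply: (fmorph_inj io).
by rewrite -s2 s0 rmorphXn rmorph0.
Qed.

Lemma absval_sqrt_gt0 : 0 < v s.
Proof. by rewrite absval_gt0 sqrt_neq0. Qed.

Lemma absval_2 : v 2%:R = 1.
Proof.
by apply: (absval_nat_coprime hp q_lt1); rewrite gtnNdvd.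
Qed.

Lemma absval_2M x : v (2%:R * x) = v x.
Proof. by rewrite absvalM absval_2 mul1r. Qed.

(* If [v (io x + s) < v s], then [Delta / x ^ 2] is so close to 1 that it is a
   square. *)
Lemma absval_addsqrt_ge x : v s <= v (io x + s).
Proof.
rewrite leNgt; apply/negP => xs.
have xNs : v (io x) = v s.
  by rewrite -(absvalN v s); apply: absval_near; rewrite opprK absvalN.
have x0 : x != 0 by rewrite -(fmorph_eq0 io) -(absval_gt0 v) xNs absval_sqrt_gt0.
have xBs : v (io x - s) = v s.
  have -> : io x - s = - (2%:R * s) + (io x + s) by ring.
  by rewrite absvalDl absvalN absval_2M.
have [|y yE] := io_sqrt (x := Delta / x ^+ 2).
  have -> : io (Delta / x ^+ 2) - 1 = - ((io x + s) * (io x - s)) / io x ^+ 2.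
    rewrite fmorph_div rmorphXn -s2; field.
    by rewrite fmorph_eq0.
  rewrite absvalM absvalN absvalV absvalX absvalM xBs xNs.
  by rewrite ltr_pdivrMr ?exprn_gt0 ?absval_sqrt_gt0// mul1r expr2 ltr_pM2r ?absval_sqrt_gt0.
apply: Delta_nsqr; exists (y * x).
by rewrite exprMn yE divfK// expf_neq0.
Qed.

(** Different absolute values give the ultrametric equality; for equal ones the previous lemma
    forbids cancellation. *)
Lemma absval_addsqrt x : v (io x + s) = Num.max (v (io x)) (v s).
Proof.
case: (ltgtP (v (io x)) (v s)) => xs.
- by rewrite absvalDr.
- by rewrite absvalDl.
- by apply/eqP; rewrite ?xs eq_le absval_addsqrt_ge andbT absvalD_le ?xs.
Qed.

Lemma absval_subsqrt x : v (io x - s) = Num.max (v (io x)) (v s).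
Proof.
have -> : io x - s = - (io (- x) + s) by rewrite rmorphN; ring.
by rewrite absvalN absval_addsqrt rmorphN absvalN.
Qed.

Lemma subsqrt_neq0 x : io x - s != 0.
Proof. by rewrite -(absval_gt0 v) absval_subsqrt lt_max absval_sqrt_gt0 orbT. Qed.

Lemma addsqrt_neq0 x : io x + s != 0.
Proof. by rewrite -(absval_gt0 v) absval_addsqrt lt_max absval_sqrt_gt0 orbT. Qed.

(** The Cayley transform, the quotient of [x + s] by its conjugate. When [K = Q(s)], Hilbert 90 says
    that these values, with 1 for infinity, are the elements of norm 1. *)
Definition cayley (x : Q) : K := (io x + s) / (io x - s).

Definition norm1 (t : K) : Prop := t = 1 \/ exists x, t = cayley x.

Lemma cayleyB1 x : cayley x - 1 = 2%:R * s / (io x - s).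
Proof. by rewrite /cayley; field; rewrite subsqrt_neq0. Qed.

Lemma cayleyD1 x : cayley x + 1 = 2%:R * io x / (io x - s).
Proof. by rewrite /cayley; field; rewrite subsqrt_neq0. Qed.

Lemma cayleyB x y : cayley x - cayley y =
  2%:R * s * (io y - io x) / ((io x - s) * (io y - s)).
Proof. by rewrite /cayley; field; rewrite !subsqrt_neq0. Qed.

Lemma absval_cayleyB1 x : v (cayley x - 1) = v s / Num.max (v (io x)) (v s).
Proof. by rewrite cayleyB1 absvalM absval_2M absvalV absval_subsqrt. Qed.

Lemma absval_cayley x : v (cayley x) = 1.
Proof.
rewrite absvalM absvalV absval_addsqrt absval_subsqrt divff//.
by rewrite gt_eqF// lt_max absval_sqrt_gt0 orbT.
Qed.

(** Both denominators in [cayleyB] have absolute value at least [v s]. *)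
Lemma absval_cayleyB_le x y :
  v (cayley x - cayley y) <= v (io x - io y) / v s.
Proof.
have vs0 := absval_sqrt_gt0.
have vX z : v s <= v (io z - s) by rewrite absval_subsqrt le_max lexx orbT.
have vX0 z : 0 < v (io z - s) by apply: lt_le_trans (vX z).
rewrite cayleyB absvalM absvalV !absvalM absval_2 mul1r absvalBC.
rewrite (_ : _ / (_ * _) = v (io x - io y) / v s *
    (v s / v (io x - s) * (v s / v (io y - s)))).
  rewrite ler_piMr ?divr_ge0 ?absval_ge0// mulr_ile1 ?divr_ge0 ?absval_ge0//.
    by rewrite ler_pdivrMr ?mul1r.
  by rewrite ler_pdivrMr ?mul1r.
by field; rewrite !gt_eqF.
Qed.

(** A local converse. The radius [v s / v (io y - s)] is the distance from [cayley y] to 1, the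
    image of infinity; within it [x] is no farther from [s] than [y] is. *)
Lemma absval_cayleyB_ge x y :
  v (cayley x - cayley y) < v s / v (io y - s) ->
  v (io x - io y) <= v (cayley x - cayley y) * (v (io y - s) ^+ 2 / v s).
Proof.
have vs0 := absval_sqrt_gt0.
have vX0 z : 0 < v (io z - s) by rewrite absval_subsqrt lt_max vs0 orbT.
have Y0 := vX0 y; have X0 := vX0 x.
have -> : v (cayley x - cayley y) =
    v s * v (io x - io y) / (v (io x - s) * v (io y - s)).
  by rewrite cayleyB absvalM absvalV !absvalM absval_2 mul1r [v (_ y - _ x)]absvalBC.
set D := v (io x - io y) => lt_near.
have [DY|DY] := leP D (v (io y - s)).
  have XY : v (io x - s) <= v (io y - s).
    have -> : io x - s = (io x - io y) + (io y - s) by ring.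
    exact: absvalD_le.
  rewrite (_ : _ * _ = D * (v (io y - s) / v (io x - s))); last first.
    by field; rewrite !gt_eqF.
  by rewrite ler_peMr ?absval_ge0// ler_pdivlMr// mul1r.
have XD : v (io x - s) <= D.
  have -> : io x - s = (io x - io y) + (io y - s) by ring.
  by apply: absvalD_le => //; exact: ltW.
move: lt_near; rewrite (_ : _ / _ = (v s / v (io y - s)) * (D / v (io x - s))).
  by rewrite ltNge ler_peMr ?divr_ge0 ?absval_ge0// ler_pdivlMr// mul1r.
by field; rewrite !gt_eqF.
Qed.

Lemma absval_cayleyB1_lt1 x : v (cayley x - 1) < 1 -> v s < v (io x).
Proof.
have vs0 := absval_sqrt_gt0.
rewrite absval_cayleyB1 ltr_pdivrMr ?mul1r ?lt_max ?vs0 ?orbT//.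
by rewrite ltxx orbF.
Qed.

Lemma absval_cayleyB1_gt x : v s < v (io x) -> v (cayley x - 1) = v s / v (io x).
Proof. by move=> xs; rewrite absval_cayleyB1 max_l// ltW. Qed.

Lemma norm1_absval t : norm1 t -> v t = 1.
Proof. by case=> [->|[x ->]]; rewrite ?absval1 ?absval_cayley. Qed.

Lemma norm1_neq0 t : norm1 t -> t != 0.
Proof. by move=> /norm1_absval t1; rewrite -(absval_gt0 v) t1. Qed.

Lemma cayleyN_mul x : cayley x * cayley (- x) = 1.
Proof.
rewrite /cayley rmorphN.
by field; rewrite subsqrt_neq0 -opprB opprK oppr_eq0 addrC addsqrt_neq0.
Qed.

(** Here [(x + s) (y + s) = (x y + Delta) + (x + y) s], and the factor [x + y] cancels against the
    conjugate. *)
Lemma cayleyM x y : x + y != 0 ->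
  cayley x * cayley y = cayley ((x * y + Delta) / (x + y)).
Proof.
move=> xy; have ioxy : io x + io y != 0 by rewrite -rmorphD fmorph_eq0.
rewrite /cayley fmorph_div !rmorphD rmorphM -s2 /=.
have E : io x * io y + s ^+ 2 + - s * (io x + io y) = (io x - s) * (io y - s).
  by ring.
field.
by rewrite !subsqrt_neq0 ioxy/= E mulf_neq0 ?subsqrt_neq0.
Qed.

Lemma norm1V t : norm1 t -> norm1 t^-1.
Proof.
case=> [->|[x ->]]; first by left; rewrite invr1.
right; exists (- x); apply: (@mulfI _ (cayley x)).
  by rewrite -(absval_gt0 v) absval_cayley.
by rewrite cayleyN_mul divff// -(absval_gt0 v) absval_cayley.
Qed.

Lemma norm1M t u : norm1 t -> norm1 u -> norm1 (t * u).
Proof.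
case=> [->|[x ->]]; first by rewrite mul1r.
case=> [->|[y ->]]; first by rewrite mulr1; right; exists x.
have [xy|xy] := eqVneq (x + y) 0; last by rewrite cayleyM//; right; eexists.
left; have -> : y = - x by apply/eqP; rewrite -addr_eq0 addrC xy.
exact: cayleyN_mul.
Qed.

Lemma norm1X t n : norm1 t -> norm1 (t ^+ n).
Proof.
move=> t1; elim: n => [|n IH]; first by left.
by rewrite exprS; exact: norm1M.
Qed.

Lemma norm1N t : norm1 t -> norm1 (- t).
Proof.
move=> t1; rewrite -mulN1r; apply: norm1M => //.
by right; exists 0; rewrite /cayley rmorph0 add0r sub0r invrN mulrN divff ?sqrt_neq0.
Qed.

(* Modulo [(u - 1) ^ 2] the power [u ^ n] is [1 + n (u - 1)], and the ratio
   [(t - 1) / (u - 1)] is congruent to an element of [Q]. *)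
Lemma norm1_approx_exp t u : norm1 t -> norm1 u -> 0 < v (u - 1) < 1 ->
  v (t - 1) = v (u - 1) -> exists n, v (t - u ^+ n) < v (u - 1).
Proof.
move=> tT uT /andP[u0 u1] tu.
case: tT tu => [->|[x ->]] tu; first by move: u0; rewrite -tu subrr absval0 ltxx.
case: uT u0 u1 tu => [->|[y ->]]; first by rewrite subrr absval0 ltxx.
move=> u0 u1 tu; set w := cayley y in u0 u1 tu *.
have xs : v s < v (io x) by apply: absval_cayleyB1_lt1; rewrite tu.
have ys : v s < v (io y) by apply: absval_cayleyB1_lt1.
have vs0 := absval_sqrt_gt0.
have x0 : 0 < v (io x) by apply: lt_trans xs.
have y0 : 0 < v (io y) by apply: lt_trans ys.
have xy : v (io x) = v (io y).
  move: tu; rewrite /w !absval_cayleyB1_gt// => /(mulfI (lt0r_neq0 vs0)).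
  exact: invr_inj.
have iox0 : io x != 0 by rewrite -(absval_gt0 v).
(* The ratio [(t - 1) / (u - 1)] is [(y - s) / (x - s)]; since [s] is smaller than [x] and [y], it
   is close to [y / x], and [n] is the class of the latter. *)
have [|n _ yxn] := io_near (x := y / x).
  by rewrite fmorph_div absvalM absvalV xy divff// gt_eqF.
exists n.
have -> : cayley x - w ^+ n =
    (w - 1) * ((io (y / x) - n%:R) + s * (io y - io x) / (io x * (io x - s)))
    - ((1 + (w - 1)) ^+ n - 1 - n%:R * (w - 1)).
  rewrite [1 + (w - 1)]addrC subrK /w cayleyB1 fmorph_div.
  have -> : cayley x = 1 + 2%:R * s / (io x - s) by rewrite -cayleyB1 addrC subrK.
  by field; rewrite !subsqrt_neq0 iox0.
apply: absvalB_lt; last first.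
  apply: le_lt_trans (absval_exp_first_order n (ltW u1)) _.
  by rewrite expr2 gtr_pMl.
rewrite absvalM gtr_pMr//; apply: absvalD_lt => //.
rewrite !absvalM absvalV absvalM absval_subsqrt max_l ?(ltW xs)//.
rewrite ltr_pdivrMr ?mulr_gt0// mul1r.
apply: (@le_lt_trans _ _ (v s * v (io x))); last by rewrite ltr_pM2r.
by rewrite ler_pM2l// absvalB_le// xy.
Qed.

(** [v s ^ 2] is a power [q ^ m]: an even [m] gives [r = q], the unramified case, an odd [m] gives
    [r ^ 2 = q], the ramified one. *)
Lemma sqrt_level :
  exists r i, [/\ v s = r * q ^ i, q <= r, r < 1 & r = q \/ r ^+ 2 = q].
Proof.
have [|m Dm] := io_val (x := Delta).
  by apply/eqP => D0; apply: Delta_nsqr; exists 0; rewrite D0 expr0n.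
have vs2 : v s ^+ 2 = q ^ m by rewrite -absvalX s2 Dm.
have qXX k : (q ^ k) ^+ 2 = q ^ (k * 2) by rewrite -exprz_exp.
have qX_gt0 k : 0 < q ^ k by rewrite exprz_gt0.
have vs0 := absval_sqrt_gt0.
have := divz_eq m 2; set k := (m %/ 2)%Z => mE.
have : (m %% 2)%Z = 0 \/ (m %% 2)%Z = 1.
  have := modz_ge0 m (d := 2) isT; have := ltz_pmod m (d := 2) isT; lia.
case=> m2; rewrite m2 in mE.
  (* The exponent is lowered by one so that [r] is [q] rather than 1. *)
  exists q, (k - 1); split=> //; last by left.
  rewrite -{1}(expr1z q) -expfzDr ?gt_eqF// addrC subrK.
  by apply: (pexpIrn (n := 2)); rewrite ?nnegrE ?(ltW vs0) ?(ltW (qX_gt0 _))// vs2 qXX mE addr0.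
pose r := v s / q ^ k.
have r0 : 0 < r by rewrite divr_gt0.
have r2 : r ^+ 2 = q.
  rewrite expr_div_n vs2 qXX mE expfzDr ?gt_eqF// expr1z mulrAC divff ?mul1r//.
  by rewrite gt_eqF.
have r1 : r < 1 by rewrite -(@expr_lt1 _ 2) ?(ltW r0)// r2.
exists r, k; split=> //; last by right.
  by rewrite /r divfK// gt_eqF.
by rewrite -r2 expr2 ger_pMl// ltW.
Qed.

(** * Distances to 1 in the group and density of powers *)

Section Level.
(* [r] is the largest value below 1 taken by [v] on the [Q]-multiples of [s]. *)
Context (r : R) (i : int) (vs : v s = r * q ^ i) (qr : q <= r) (r1 : r < 1).

Let r_gt0 : 0 < r. Proof. exact: lt_le_trans q_gt0 qr. Qed.

Let qX_gt0 n : 0 < q ^+ n. Proof. by rewrite exprn_gt0. Qed.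

(** The distance [v s / v (io x)] is [r] times a power of [q]; being below 1 excludes negative
    exponents, as [q <= r]. *)
Lemma norm1_level t : norm1 t -> v (t - 1) < 1 -> t != 1 ->
  exists n, v (t - 1) = q ^+ n * r.
Proof.
move=> [->|[x ->]]; first by rewrite eqxx.
move=> x1 _; have xs := absval_cayleyB1_lt1 x1.
rewrite absval_cayleyB1_gt// in x1 *.
have x0 : x != 0.
  rewrite -(fmorph_eq0 io) -(absval_gt0 v).
  by apply: lt_trans xs; exact: absval_sqrt_gt0.
have [k xk] := io_val x0.
have E : v s / v (io x) = q ^ (i - k) * r.
  by rewrite vs xk expfzDr ?gt_eqF// -invr_expz; ring.
rewrite E in x1 *; case: (i - k) x1 => n; first by exists n.
rewrite NegzE -exprnN mulrC ltr_pdivrMr// mul1r => rq.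
have : q ^+ n.+1 <= q by rewrite exprS ger_pMr// exprn_ile1 ?ltW.
by move=> /(lt_le_trans rq); rewrite ltNge qr.
Qed.

Lemma norm1_gap t n : norm1 t -> v (t - 1) < q ^+ n * r ->
  v (t - 1) <= q ^+ n.+1 * r.
Proof.
move=> tT tn; have [->|t1] := eqVneq t 1.
  by rewrite subrr absval0 mulr_ge0 ?exprn_ge0 ?ltW.
have qnr1 : q ^+ n * r <= 1 by rewrite mulr_ile1 ?exprn_ile1 ?ltW.
have [m E] := norm1_level tT (lt_le_trans tn qnr1) t1.
move: tn; rewrite E ltr_pM2r// ler_pM2r// ltr_iXn2l//.
by move=> nm; rewrite ler_iXn2l.
Qed.

Lemma norm1_gap1 t : norm1 t -> v (t - 1) < 1 -> v (t - 1) <= r.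
Proof.
move=> tT tn; have [->|t1] := eqVneq t 1.
  by rewrite subrr absval0 ltW.
have [m ->] := norm1_level tT tn t1.
by rewrite ger_pMl// exprn_ile1 ?ltW.
Qed.

Lemma norm1_ex n : exists2 t, norm1 t & v (t - 1) = q ^+ n * r.
Proof.
(* The parameter has absolute value [q ^ (i - n)], and [v s = r q ^ i] divided by it is
   [q ^ n r]. *)
exists (cayley (p%:R ^ (i - n%:Z))); first by right; eexists.
have vX : v (io (p%:R ^ (i - n%:Z))) = q ^ i / q ^+ n.
  by rewrite fmorphXz rmorph_nat absvalXz expfzDr ?gt_eqF// -invr_expz.
have qi : 0 < q ^ i by rewrite exprz_gt0.
rewrite absval_cayleyB1_gt vX vs.
  by field; rewrite !gt_eqF.
rewrite ltr_pdivlMr// mulrAC gtr_pMl//.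
by rewrite (le_lt_trans _ r1)// ger_pMr// exprn_ile1 ?ltW.
Qed.

Lemma absval_divB1 t u : norm1 u -> v (t / u - 1) = v (t - u).
Proof.
move=> u1; have u0 := norm1_neq0 u1.
by rewrite -[1](divff u0) -mulrBl absvalM absvalV (norm1_absval u1) invr1 mulr1.
Qed.

(** After the first [p]-th power the distance to 1 is at most [q], and each further one multiplies
    it by exactly [q]. Only the first step has to be assumed. *)
Lemma norm1_exp_primeX t k : norm1 t -> v (t - 1) = r -> v (t ^+ p - 1) = q * r ->
  v (t ^+ (p ^ k) - 1) = q ^+ k * r.
Proof.
move=> tT t1 tp; elim: k => [|k IH]; first by rewrite expn0 !expr1 expr0 mul1r.
case: k IH => [_|k IH]; first by rewrite expn1 expr1.
have qk : v (t ^+ (p ^ k.+1) - 1) <= q.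
  by rewrite IH exprS -mulrA ger_pMr// mulr_ile1 ?exprn_ile1 ?ltW.
by rewrite expnSr exprM (absval_exp_primeB1 hp q_lt1 p_gt2 qk) IH mulrA -exprS.
Qed.

(** By [absval_addsqrt] a nonzero value is a power of [q] or [r] times one; below 1, both kinds are
    at most [r]. *)
Lemma absval_lt1_le_level x y : v (io x + io y * s) < 1 -> v (io x + io y * s) <= r.
Proof.
have qXr k : q ^ k < 1 -> q ^ k <= r.
  case: k => [[|n]|n] qk; first by rewrite expr0z ltxx in qk.
    by apply: le_trans qr; rewrite -exprnP exprS ger_pMr// exprn_ile1 ?ltW.
  have q1 : q ^+ n.+1 <= 1 by rewrite exprn_ile1 ?ltW.
  move: qk; rewrite NegzE -exprnN ltNge invf_ge1 ?exprn_gt0//. by rewrite q1.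
have io_le u : v (io u) < 1 -> v (io u) <= r.
  have [->|u0] := eqVneq u 0; first by rewrite rmorph0 absval0 ltW.
  by have [k ->] := io_val u0; apply: qXr.
have [->|y0] := eqVneq y 0; first by rewrite rmorph0 mul0r addr0; apply: io_le.
have [k yk] := io_val y0.
have ioy0 : io y != 0 by rewrite fmorph_eq0.
have -> : io x + io y * s = io y * (io (x / y) + s).
  by rewrite fmorph_div; field.
rewrite absvalM absval_addsqrt.
case: (leP (v (io (x / y))) (v s)) => _.
  rewrite yk vs mulrCA -expfzDr ?gt_eqF//.
  case: (k + i) => n rq.
    by rewrite ger_pMr// -exprnP exprn_ile1 ?ltW.
  move: rq; rewrite NegzE -exprnN ltr_pdivrMr// mul1r => rq.
  have : q ^+ n.+1 <= q by rewrite exprS ger_pMr// exprn_ile1 ?ltW.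
  by move=> /(lt_le_trans rq); rewrite ltNge qr.
by rewrite -absvalM -rmorphM; apply: io_le.
Qed.

Lemma uniformizer_level (pi : K) :
  (forall z, exists x y, z = io x + io y * s) ->
  v pi < 1 -> (forall z, v z < 1 -> v z <= v pi) -> v pi = r.
Proof.
move=> coord pi1 pimax; apply/eqP; rewrite eq_le; apply/andP; split.
  have [x [y E]] := coord pi.
  by rewrite E absval_lt1_le_level// -E.
have [t _] := norm1_ex 0; rewrite expr0 mul1r => t1.
by rewrite -t1 pimax// t1.
Qed.

Definition powers_dense (L : K) : Prop :=
  forall t, norm1 t -> forall k, exists n, v (L ^+ n - t) <= q ^+ k.

(** Successive approximation with [mu = L ^ m]. The residue classes give a start at distance at most
    [r]. If the distance is exactly [q ^ k r], that is also the distance of [mu ^ (p ^ k)] from 1,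
    and a power of it corrects the error; if it is smaller, the gap between distances already gives
    the next level. *)
Lemma norm1_powers_dense L m : norm1 L ->
  (forall t, norm1 t -> exists j, v (t - L ^+ j) < 1) ->
  v (L ^+ m - 1) = r -> v (L ^+ m ^+ p - 1) = q * r -> powers_dense L.
Proof.
move=> LT cover Lm Lmp t tT k.
suff [n nE] : exists n, v (L ^+ n - t) <= q ^+ k * r.
  exists n; apply: le_trans nE _.
  by rewrite ger_pMr// ltW.
have LXT n : norm1 (L ^+ n) by apply: norm1X.
have divT u n : norm1 u -> norm1 (u / L ^+ n) by move=> uT; apply/norm1M/norm1V.
elim: k => [|k [n IH]].
  have [j tj] := cover t tT; exists j.
  rewrite expr0 mul1r absvalBC -absval_divB1//.
  by rewrite norm1_gap1 ?absval_divB1//; exact: divT.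
move: IH; rewrite le_eqVlt => /orP[/eqP tn|tn]; last first.
  exists n; rewrite absvalBC -absval_divB1//.
  by apply: norm1_gap; rewrite ?absval_divB1 1?absvalBC//; exact: divT.
have w1 := norm1_exp_primeX k (LXT m) Lm Lmp.
have qkr : 0 < q ^+ k * r < 1.
  rewrite mulr_gt0//=; apply: le_lt_trans r1.
  by rewrite ger_pMl// exprn_ile1 ?ltW.
have [||||j tj] := @norm1_approx_exp (t / L ^+ n) (L ^+ m ^+ (p ^ k)).
- exact: divT.
- by apply: norm1X.
- by rewrite w1.
- by rewrite w1 absval_divB1// absvalBC.
rewrite w1 -!exprM mulnA in tj.
exists (m * p ^ k * j + n)%N; rewrite absvalBC -absval_divB1//.
have E : t / L ^+ (m * p ^ k * j + n) = t / L ^+ n / L ^+ (m * p ^ k * j).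
  by rewrite exprD invfM; ring.
apply: norm1_gap; first exact: divT.
by rewrite E absval_divB1.
Qed.

End Level.

Lemma absval_natB n m : (n < m < p)%N -> v (m%:R - n%:R) = 1.
Proof.
move=> /andP[nm mp]; rewrite -natrB ?(ltnW nm)//.
apply: (absval_nat_coprime hp q_lt1); rewrite gtnNdvd ?subn_gt0//.
by rewrite (leq_ltn_trans _ mp)// leq_subr.
Qed.

Lemma powers_dense_residue L t : norm1 L -> norm1 t -> powers_dense L ->
  exists n, residue v t = residue v L ^+ n.
Proof.
move=> LT tT /(_ t tT 1%N)[n tn]; exists n; apply/eqP.
have LnT := norm1X n LT.
rewrite -residueX ?(norm1_absval LT)// residue_eq ?(norm1_absval tT) ?(norm1_absval LnT)//.
by rewrite absvalBC (le_lt_trans tn)// expr1.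
Qed.

(** * The unramified case: counting residue classes *)

Section Unramified.
Context (i : int) (vs : v s = q * q ^ i).
Context (L : K) (LT : norm1 L) (l : nat) (l_order : l.-primitive_root (residue v L)).

(** An element of [Q] with the absolute value of [s], used to scale parameters to integral ones. *)
Let g : Q := p%:R ^ (i + 1).

Let vg : v (io g) = v s.
Proof. by rewrite fmorphXz rmorph_nat absvalXz expfzDr ?gt_eqF// vs mulrC. Qed.

Let vs0 : 0 < v s. Proof. exact: absval_sqrt_gt0. Qed.

Let le_vgn (n : nat) : v (io (g * n%:R)) <= v s.
Proof.
by rewrite rmorphM rmorph_nat absvalM vg ler_piMr ?absval_ge0 ?absval_nat_le1.
Qed.

(** The projective line over the field with [p] elements: the class of 1 is its point at
    infinity. *)
Definition norm1_residues : seq (residue_field v) :=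
  residue v 1 :: [seq residue v (cayley (g * n%:R)) | n <- iota 0 p].

Lemma norm1_residuesP t : norm1 t -> residue v t \in norm1_residues.
Proof.
case=> [->|[x ->]]; first exact: mem_head.
rewrite inE; apply/orP.
have [xs|xs] := ltP (v s) (v (io x)).
  left; rewrite residue_eq ?absval1 ?absval_cayley// absval_cayleyB1_gt//.
  by rewrite ltr_pdivrMr ?mul1r// (lt_trans vs0).
right; have iog0 : io g != 0 by rewrite -(absval_gt0 v) vg.
have [|n np xn] := io_near (x := x / g).
  by rewrite fmorph_div absvalM absvalV vg ler_pdivrMr// mul1r.
apply/mapP; exists n; first by rewrite mem_iota.
apply/eqP; rewrite residue_eq ?absval_cayley// cayleyB.
rewrite absvalM absvalV !absvalM !absval_subsqrt !max_r// absval_2 mul1r.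
rewrite ltr_pdivrMr ?mulr_gt0// mul1r ltr_pM2l// absvalBC rmorphM rmorph_nat.
have -> : io x - io g * n%:R = io g * (io (x / g) - n%:R).
  by rewrite fmorph_div; field.
by rewrite absvalM vg gtr_pMr.
Qed.

Lemma norm1_residues_uniq : uniq norm1_residues.
Proof.
rewrite /=; apply/andP; split.
  apply/mapP => -[n _ /eqP]; rewrite residue_eq ?absval1 ?absval_cayley//.
  by rewrite absvalBC absval_cayleyB1 max_r// divff ?gt_eqF// ltxx.
rewrite map_inj_in_uniq ?iota_uniq// => m n.
rewrite !mem_iota /= !add0n => mp np /eqP.
rewrite residue_eq ?absval_cayley// cayleyB.
rewrite absvalM absvalV !absvalM !absval_subsqrt !max_r// absval_2 mul1r.
rewrite ltr_pdivrMr ?mulr_gt0// mul1r ltr_pM2l// !rmorphM !rmorph_nat -mulrBr.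
rewrite absvalM vg gtr_pMr//.
case: (ltngtP m n) => // mn.
  by rewrite absval_natB ?mn// ltxx.
by rewrite absvalBC absval_natB ?mn// ltxx.
Qed.

Let powers : seq (residue_field v) := [seq residue v L ^+ j | j <- iota 0 l].

Let powers_uniq : uniq powers.
Proof.
rewrite map_inj_in_uniq ?iota_uniq// => m n.
rewrite !mem_iota /= !add0n => mp np /eqP.
by rewrite (eq_prim_root_expr l_order) !modn_small// => /eqP.
Qed.

Let powers_sub : {subset powers <= norm1_residues}.
Proof.
move=> _ /mapP[j _ ->]; rewrite -residueX ?(norm1_absval LT)//.
by apply: norm1_residuesP; exact: norm1X.
Qed.

(** Dense powers exhaust the [p + 1] classes, and one of them lies at distance [q] from 1; its
    exponent is a multiple of [l], so [L ^ l] cannot be closer. Conversely, counting shows that the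
    powers meet all classes, and the condition on the [p]-th power of [L ^ l] is automatic at
    distance [q]. *)
Lemma powers_dense_unramified :
  powers_dense L <-> l = p.+1 /\ v (L ^+ l - 1) = q.
Proof.
have vL : v L <= 1 by rewrite (norm1_absval LT).
have vLX j : v (L ^+ j) <= 1 by rewrite absvalX exprn_ile1 ?absval_ge0.
have LXT j : norm1 (L ^+ j) by apply: norm1X.
have Ldvd j : (v (L ^+ j - 1) < 1) = (l %| j)%N.
  rewrite -residue_eq ?absval1// residueX// residue1.
  by rewrite -(prim_order_dvd l_order).
have szS : size norm1_residues = p.+1 by rewrite /= size_map size_iota.
have szW : size powers = l by rewrite size_map size_iota.
split=> [dL|[lp Ll]].
  have lp : l = p.+1.
    apply/eqP; rewrite eqn_leq -szW -{1}szS uniq_leq_size//= -szS.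
    apply: uniq_leq_size norm1_residues_uniq _ => a.
    have res t : norm1 t -> residue v t \in powers.
      move=> tT; have [n ->] := powers_dense_residue LT tT dL.
      rewrite -(prim_expr_mod l_order); apply: map_f.
      by rewrite mem_iota /= add0n ltn_mod (prim_order_gt0 l_order).
    rewrite inE => /orP[/eqP ->|/mapP[n _ ->]]; apply: res; first by left.
    by right; eexists.
  split=> //; apply/eqP; rewrite eq_le (norm1_gap1 vs (lexx q))//; last by rewrite Ldvd.
  have [t tT t1] := norm1_ex vs (lexx q) q_lt1 0.
  rewrite expr0 mul1r in t1.
  (* Precision [q ^ 2 < q] forces [L ^ n] to be at the same distance from 1 as [t]. *)
  have [n tn] := dL t tT 2.
  have tnq : v (L ^+ n - t) < q.
    by apply: le_lt_trans tn _; rewrite expr2 gtr_pMr.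
  have Ln : v (L ^+ n - 1) = q.
    by rewrite -t1; apply: absval_near; rewrite opprB addrA subrK t1.
  have /dvdnP[k nE] : (l %| n)%N by rewrite -Ldvd Ln.
  by rewrite /= -{1}Ln nE mulnC exprM absval_expB1_le.
apply: (norm1_powers_dense vs (lexx q) q_lt1 (m := l)) => //.
  move=> t tT.
  have [_ E] : (size powers = size norm1_residues) * (powers =i norm1_residues).
    by apply: uniq_min_size => //; rewrite szS szW lp.
  have := norm1_residuesP tT; rewrite -E => /mapP[j _ tj]; exists j.
  by rewrite -residue_eq ?(norm1_absval tT)// tj residueX.
by rewrite (absval_exp_primeB1 hp q_lt1 p_gt2) Ll.
Qed.

End Unramified.

(** * The ramified case: the classes of 1 and -1 *)

Section Ramified.
Context (r : R) (i : int) (vs : v s = r * q ^ i) (r0 : 0 < r) (r2 : r ^+ 2 = q).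
Context (L : K) (LT : norm1 L).

Let r1 : r < 1.
Proof. by rewrite -(@expr_lt1 _ 2) ?(ltW r0)// r2. Qed.

Let qr : q <= r.
Proof. by rewrite -r2 expr2 ger_pMl// ltW. Qed.

Let vs0 : 0 < v s. Proof. exact: absval_sqrt_gt0. Qed.

(** A parameter larger than [s] gives the class of 1, a smaller one that of -1. Equality would make
    [r] a power of [q], contradicting [r ^ 2 = q] by parity. *)
Lemma norm1_ramified t : norm1 t -> v (t - 1) < 1 \/ v (t + 1) < 1.
Proof.
case=> [->|[x ->]]; first by left; rewrite subrr absval0.
case: (ltgtP (v s) (v (io x))) => xs.
- by left; rewrite absval_cayleyB1_gt// ltr_pdivrMr ?mul1r// (lt_trans vs0).
- right; rewrite cayleyD1 absvalM absval_2M absvalV absval_subsqrt max_r ?ltW//.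
  by rewrite ltr_pdivrMr ?mul1r.
have x0 : x != 0 by rewrite -(fmorph_eq0 io) -(absval_gt0 v) -xs.
have [k xk] := io_val x0.
have rE : r = q ^ (k - i).
  apply: (@mulIf _ (q ^ i)); first by rewrite expfz_neq0// gt_eqF.
  by rewrite -vs xs xk -expfzDr ?gt_eqF// subrK.
move: (r2); rewrite {1}rE exprnP exprz_exp -[RHS]expr1z => E.
by have := ieexprIz q_gt0 (negbT (lt_eqF q_lt1)) E; lia.
Qed.

(** The condition is stated through [M = - L], which must lie in the class of 1 since the powers of
    [L] have to reach -1. Density forces the distances [r] and [q r] to occur among the powers of
    [M], hence for [M] and [M ^ p]. The converse uses [L ^ 2 = M ^ 2]. *)
Lemma powers_dense_ramified : powers_dense L <-> v (L ^+ p + 1) = r ^+ 3.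
Proof.
have qrE : r ^+ 3 = q * r by rewrite exprSr r2.
have podd : odd p by case: (even_prime hp) p_gt2 => [->|].
have [M ME] : exists M, M = - L by exists (- L).
have MT : norm1 M by rewrite ME; apply: norm1N.
have MXT j : norm1 (M ^+ j) by apply: norm1X.
have vM : v M <= 1 by rewrite (norm1_absval MT).
have LpE : v (L ^+ p + 1) = v (M ^+ p - 1).
  by rewrite ME exprNn -signr_odd podd expr1 mulN1r -opprD absvalN.
have MpE : v (M - 1) <= r -> v (M ^+ p - 1) <= q * v (M - 1).
  move=> Mr; apply: (absval_exp_primeB1_le hp) => //.
    by rewrite (le_trans Mr)// ltW.
  by rewrite -r2 ler_pXn2r ?nnegrE ?absval_ge0 ?(ltW r0).
have M1E : v (M + 1) < 1 -> v (M ^+ p - 1) = 1.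
  move=> M1; have Mp : v (M ^+ p + 1) < 1.
    have -> : M ^+ p + 1 = - ((- M) ^+ p - 1).
      by rewrite exprNn -signr_odd podd expr1; ring.
    rewrite absvalN; apply: le_lt_trans (absval_expB1_le _ _) _.
      by rewrite absvalN.
    by rewrite -absvalN opprB opprK addrC.
  have -> : M ^+ p - 1 = - 2%:R + (M ^+ p + 1) by ring.
  by rewrite absvalDl absvalN absval_2.
have gapM : v (M - 1) < r -> v (M - 1) <= q * r.
  move=> Mr; rewrite -(expr1 q); apply: (norm1_gap vs qr r1 (n := 0)) => //.
  by rewrite expr0 mul1r.
split=> [dL|Lp].
  have M1 : v (M - 1) < 1.
    case: (norm1_ramified MT) => // M1.
    have NT : norm1 (-1) by apply: norm1N; left.
    have [n tn] := dL _ NT 1%N.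
    have L1 : v (L - 1) < 1 by rewrite -absvalN opprB addrC -ME.
    have : v (L ^+ n - 1 - (L ^+ n + 1)) < 1.
      apply: absvalB_lt.
        apply: le_lt_trans (absval_expB1_le _ _) L1.
        by rewrite (norm1_absval LT).
      by rewrite -[1]opprK (le_lt_trans tn)// expr1.
    have -> : L ^+ n - 1 - (L ^+ n + 1) = - 2%:R by ring.
    by rewrite absvalN absval_2 ltxx.
  have approx t k : norm1 t -> v (t - 1) = q ^+ k * r ->
      exists n, v (M ^+ n - 1) = q ^+ k * r.
    move=> tT t1; have [n tn] := dL t tT k.+2; exists n.
    have qkr : q ^+ k * r < 1.
      by apply: le_lt_trans r1; rewrite ger_pMl// exprn_ile1 ?ltW.
    have tn' : v (L ^+ n - t) < q ^+ k * r.
      apply: le_lt_trans tn _; rewrite !exprSr -mulrA ltr_pM2l ?exprn_gt0//.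
      by apply: lt_le_trans qr; rewrite gtr_pMl.
    rewrite -t1; apply: absval_near; rewrite opprB addrA subrK t1.
    have LM : L ^+ n = (-1) ^+ odd n * M ^+ n by rewrite signr_odd -exprNn ME opprK.
    (* An odd [n] would put [L ^ n] in the class of -1, while [t] is in the class of 1 and 2 is a
       unit. *)
    case: (odd n) LM => LM; last by rewrite LM expr0 mul1r in tn'.
    have : v ((L ^+ n - t) + (t - 1) + (M ^+ n - 1)) < 1.
      apply: absvalD_lt; first apply: absvalD_lt.
      - exact: lt_trans tn' qkr.
      - by rewrite t1.
      - exact: le_lt_trans (absval_expB1_le _ vM) M1.
    have -> : L ^+ n - t + (t - 1) + (M ^+ n - 1) = - 2%:R by rewrite LM; ring.
    by rewrite absvalN absval_2 ltxx.
  have Mr : v (M - 1) = r.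
    apply/eqP; rewrite eq_le (norm1_gap1 vs qr)//=.
    have [t tT t1] := norm1_ex vs qr r1 0.
    have [n] := approx t 0%N tT t1; rewrite expr0 mul1r => <-.
    exact: absval_expB1_le.
  have := MpE; rewrite Mr => /(_ (lexx r)) Mple.
  apply/eqP; rewrite LpE qrE eq_le Mple /= leNgt; apply/negP => Mp.
  have Mp2 : v (M ^+ p - 1) <= q ^+ 2 * r.
    by apply: (norm1_gap vs qr r1) => //; rewrite expr1.
  have [t tT t1] := norm1_ex vs qr r1 1.
  have [n] := approx t 1%N tT t1; rewrite expr1 => Mn.
  have qrr : q * r < r by rewrite gtr_pMl.
  (* Exponents divisible by [p] give distance at most that of [M ^ p], the others exactly [r];
     neither is [q r]. *)
  have [/dvdnP[k nE]|pn] := boolP (p %| n)%N.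
    have : v (M ^+ n - 1) <= q ^+ 2 * r.
      apply: le_trans Mp2; rewrite nE mulnC exprM absval_expB1_le//.
      by rewrite (norm1_absval (MXT p)).
    by rewrite Mn expr2 -mulrA leNgt gtr_pMl ?mulr_gt0// q_lt1.
  move: Mn; rewrite (absval_expB1_coprime hp q_lt1)// Mr => /eqP.
  by rewrite gt_eqF.
rewrite LpE qrE in Lp.
have M1 : v (M - 1) < 1.
  case: (norm1_ramified MT) => // /M1E; rewrite Lp => /eqP.
  by rewrite lt_eqF// (le_lt_trans _ r1)// ger_pMl ?ltW.
have Mr : v (M - 1) = r.
  apply/eqP; rewrite eq_le (norm1_gap1 vs qr)//=.
  by rewrite -(ler_pM2l q_gt0) -Lp MpE// (norm1_gap1 vs qr).
have unit2 t : v (t - 1) < 1 -> v (t + 1) = 1.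
  move=> t1; have -> : t + 1 = 2%:R + (t - 1) by ring.
  by rewrite absvalDl absval_2.
(* The second factor is a unit, so squaring keeps the distances while removing the sign. *)
have L2E n : v (L ^+ 2 ^+ n - 1) = v (M ^+ n - 1) * v (M ^+ n + 1).
  rewrite -absvalM; congr (v _).
  have -> : L = - M by rewrite ME opprK.
  by rewrite sqrrN -exprM mulnC exprM; ring.
have MX1 n : v (M ^+ n - 1) < 1 by apply: le_lt_trans M1; exact: absval_expB1_le.
apply: (norm1_powers_dense vs qr r1 (m := 2)) => //.
- move=> t tT; case: (norm1_ramified tT) => t1.
    by exists 0%N; rewrite expr0.
  exists 1%N; rewrite expr1.
  have -> : t - L = (t + 1) + (M - 1) by rewrite ME; ring.
  exact: absvalD_lt.
- by rewrite -[L ^+ 2]expr1 L2E expr1 unit2// mulr1.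
- by rewrite L2E unit2// mulr1.
Qed.

End Ramified.
End NormOneGroup.

(** * Topology of the projective line *)

Section PadicProjectiveLine.
Context (p : nat) (hp : prime p).
Local Notation Qp := (padic hp).
Local Notation A := (padic_absval hp).
Local Open Scope classical_set_scope.

Lemma padic_ballE (x : Qp) (d : rat) : ball x d = [set y | A (x - y) < d].
Proof. by []. Qed.

(** The sequence [p ^- n] leaves every bounded set, whereas a cluster point [c] would bring it back
    below [max 1 |c|]. *)
Lemma padic_not_compact : ~ compact [set: Qp].
Proof.
move=> /(_ ((fun n => p%:R ^- n : Qp) @ \oo) _ filterT)[c [_ cl]].
pose M := Num.max 1 (A c).
have vn n : A (p%:R ^- n) = p%:R ^+ n.
  by rewrite absvalV absvalX padic_absval_prime exprVn invrK.
have FM : ((fun n => p%:R ^- n : Qp) @ \oo) [set x | M < A x].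
  have M0 : 0 <= M by rewrite le_max ler01.
  exists (Num.bound M) => // n /= nM; rewrite -[ltRHS]/(A (p%:R ^- n)) vn.
  apply: lt_le_trans (archi_boundP M0) _.
  rewrite -natrX ler_nat (leq_trans nM)// ltnW// ltn_expl// prime_gt1//.
have [x [/= Mx]] := cl _ _ FM (nbhsx_ballx c 1 ltr01).
rewrite padic_ballE /= => cx.
have : A x <= M.
  have -> : x = c - (c - x) by ring.
  by apply: absvalB_le; rewrite le_max ?lexx ?orbT// (ltW cx).
by rewrite leNgt Mx.
Qed.

(** Reduces density to finite balls: a neighbourhood of infinity has a compact complement in Q_p,
    hence contains a finite point. *)
Lemma padic_P1_open_ball (O : set (padic_P1 hp)) : open O -> O !=set0 ->
  exists y : Qp, exists2 d, 0 < d & forall z : Qp, A (y - z) < d -> O (Some z).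
Proof.
move=> oO [w Ow].
have [y Oy] : exists y : Qp, O (Some y).
  case: w Ow => [y|] Ow; first by exists y.
  have [C] : nbhs (None : padic_P1 hp) O by apply: open_nbhs_nbhs.
  move=> [cC _] CO.
  have [y Cy] : exists y, ~ C y.
    apply/existsNP => CT; apply: padic_not_compact.
    by have <- : C = setT by apply/seteqP; split.
  by exists y; apply: CO; left; exists y.
have : nbhs y (fun z => O (Some z)).
  by have : nbhs (Some y : padic_P1 hp) O by apply: open_nbhs_nbhs.
move=> /nbhs_ballP[d /= d0 dO]; exists y, d => // z yz; exact: dO.
Qed.

Lemma padic_P1_dense_near (S : set (padic_P1 hp)) (y : Qp) (d : rat) :
  dense S -> 0 < d -> exists2 z : Qp, A (y - z) < d & S (Some z).
Proof.
move=> dS d0.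
have oU : open (Some @` (ball y d)^° : set (padic_P1 hp)).
  by apply: one_point_compactification_open_some; exact: open_interior.
have [|_ [[z zy <-] Sz]] := dS _ _ oU.
  by exists (Some y), y => //; exact: nbhsx_ballx.
exists z => //; exact: (interior_subset zy).
Qed.

End PadicProjectiveLine.

(** * The numerical coordinate attached to the fixed points *)

Section FixedPointCoordinate.
Context (F : fieldType) (a b c d : F).
Implicit Types x y : F.

(* [num_coord x ^+ 2 = (d - a) ^+ 2 + 4 b c] is the equation of the fixed points. *)
Definition num_coord x : F := 2%:R * c * x + d - a.

Lemma num_coordB x y : num_coord x - num_coord y = 2%:R * (c * (x - y)).
Proof. by rewrite /num_coord; ring. Qed.

Lemma num_coord_image_oo : c != 0 -> num_coord (a / c) = a + d.
Proof. by move=> c0; rewrite /num_coord; field. Qed.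

Lemma num_coord_pole x : c * x + d = 0 -> num_coord x = - (a + d).
Proof.
move=> cxd; rewrite /num_coord; have -> : d = - (c * x) by apply/eqP; rewrite -addr_eq0 addrC cxd.
by ring.
Qed.

Lemma addr_num_coord x : a + d + num_coord x = 2%:R * (c * x + d).
Proof. by rewrite /num_coord; ring. Qed.

(** The left side is the addition formula of [cayleyM] for the parameters [a + d] and [num_coord x],
    given [addr_num_coord]. *)
Lemma num_coord_image x : 2%:R != 0 :> F -> c * x + d != 0 ->
  ((a + d) * num_coord x + ((d - a) ^+ 2 + 4%:R * b * c)) / (2%:R * (c * x + d)) =
  num_coord ((a * x + b) / (c * x + d)).
Proof. by move=> two0 cxd; rewrite /num_coord; field; rewrite cxd two0. Qed.

Lemma num_coord_surj x : 2%:R != 0 :> F -> c != 0 ->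
  num_coord ((x - d + a) / (2%:R * c)) = x.
Proof. by move=> two0 c0; rewrite /num_coord; field; rewrite two0 c0. Qed.

End FixedPointCoordinate.

(** * Conjugacy of the homography with a multiplication *)

Section Conjugacy.
Context (R : realType) (p : nat) (hp : prime p) (p_gt2 : (2 < p)%N).
Local Notation Qp := (padic hp).
Local Notation A := (padic_absval hp).
Context (a b c d : Qp) (Delta : Qp) (DeltaE : Delta = (d - a) ^+ 2 + 4%:R * b * c).
Context (Delta_nsqr : ~ exists x : Qp, x ^+ 2 = Delta).
Context (K : fieldType) (io : {rmorphism Qp -> K}) (s : K) (s2 : s ^+ 2 = io Delta).
Context (v : absval R K) (ext_absvalE : forall x, v (io x) = ratr (A x)).
Local Notation q := (v p%:R).
Local Notation cay := (cayley io s).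

Lemma ext_absval_prime : q = p%:R^-1.
Proof.
rewrite -(rmorph_nat io) ext_absvalE padic_absval_prime fmorphV.
by rewrite rmorph_nat.
Qed.

Lemma ext_q01 : 0 < q < 1.
Proof.
rewrite ext_absval_prime invr_gt0 ltr0n prime_gt0//=.
by rewrite invf_lt1 ?ltr0n ?prime_gt0// ltr1n prime_gt1.
Qed.

Lemma ext_val x : x != 0 -> exists k : int, v (io x) = q ^ k.
Proof.
move=> /padic_absvalE[k xk]; exists (- k).
by rewrite ext_absvalE xk fmorphXz rmorph_nat ext_absval_prime exprz_inv opprK.
Qed.

Let ratr1 : 1 = ratr 1 :> R. Proof. by rewrite rmorph1. Qed.

Lemma ext_near x : v (io x) <= 1 ->
  exists2 n : nat, (n < p)%N & v (io x - n%:R) < 1.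
Proof.
rewrite ext_absvalE ratr1 ler_rat => /padic_near_nat[n np xn]; exists n => //.
by rewrite -(rmorph_nat io) -rmorphB ext_absvalE ltr_rat.
Qed.

Lemma ext_sqrt x : v (io x - 1) < 1 -> exists y, y ^+ 2 = x.
Proof.
rewrite -(rmorph1 io) -rmorphB ext_absvalE ratr1 ltr_rat.
exact: padic_sqrt.
Qed.

Let q_gt0 : 0 < q. Proof. by case/andP: ext_q01. Qed.
Let q_lt1 : q < 1. Proof. by case/andP: ext_q01. Qed.

Lemma ext_qX_lt (eps : R) : 0 < eps -> exists k, q ^+ k < eps.
Proof.
move=> e0; have ei0 : 0 <= eps^-1 by rewrite invr_ge0 ltW.
exists (Num.bound eps^-1); rewrite ext_absval_prime exprVn.
rewrite invf_plt ?posrE ?exprn_gt0 ?ltr0n ?prime_gt0//.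
apply: lt_le_trans (archi_boundP ei0) _.
by rewrite -natrX ler_nat ltnW// ltn_expl// prime_gt1.
Qed.

Let c_neq0 : c != 0.
Proof.
apply/eqP => c0; apply: Delta_nsqr; exists (d - a).
by rewrite DeltaE c0 mulr0 addr0.
Qed.

Let two_neq0 : 2%:R != 0 :> Qp.
Proof.
rewrite -(fmorph_eq0 io) -(absval_gt0 v) rmorph_nat.
by rewrite (absval_2 hp p_gt2 ext_q01).
Qed.

Local Notation X := (num_coord a c d).

(* The coordinate on the projective line that sends the two fixed points of
   the homography to 0 and infinity, normalised by [oo |-> 1]. *)
Definition fix_coord (x : padic_P1 hp) : K :=
  if x is Some x then cay (X x) else 1.

(** The cases match the group law: infinity goes to the parameter [a + d], the pole has the opposite
    parameter and goes to 1, and elsewhere [cayleyM] applies. *)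
Lemma fix_coord_homography x :
  fix_coord (homography a b c d x) = cay (a + d) * fix_coord x.
Proof.
case: x => [x|] /=; last first.
  rewrite (negbTE c_neq0) mulr1.
  by rewrite [LHS]/fix_coord (num_coord_image_oo a d c_neq0).
have [cxd|cxd] := eqVneq (c * x + d) 0.
  rewrite (num_coord_pole _ cxd).
  by rewrite (cayleyN_mul hp p_gt2 ext_q01 ext_sqrt Delta_nsqr s2).
have nz : a + d + X x != 0.
  by rewrite addr_num_coord; exact: mulf_neq0 two_neq0 cxd.
rewrite (cayleyM hp p_gt2 ext_q01 ext_sqrt Delta_nsqr s2 nz).
by rewrite addr_num_coord DeltaE (num_coord_image a b two_neq0 cxd).
Qed.

Lemma fix_coord_iter n x :
  fix_coord (iter n (homography a b c d) x) = cay (a + d) ^+ n * fix_coord x.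
Proof.
elim: n => [|n IH]; first by rewrite expr0 mul1r.
by rewrite iterS fix_coord_homography IH exprS mulrA.
Qed.

Lemma fix_coord_norm1 x : norm1 io s (fix_coord x).
Proof. by case: x => [x|]; [right; eexists|left]. Qed.

Lemma fix_coord_surj t : norm1 io s t -> exists x, fix_coord x = t.
Proof.
case=> [->|[x ->]]; first by exists None.
exists (Some ((x - d + a) / (2%:R * c))).
exact: (congr1 cay (num_coord_surj a d x two_neq0 c_neq0)).
Qed.

(** The orbit of infinity has the powers of [cay (a + d)] as coordinates, and the coordinate is
    Lipschitz. Conversely, for an orbit from [x], the target is divided by the coordinate of [x] and
    the local converse estimate returns to Q_p. *)
Lemma minimal_homography :
  minimal (homography a b c d) <-> powers_dense p io v s (cay (a + d)).
Proof.
have sg := absval_sqrt_gt0 v Delta_nsqr s2.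
have vc0 : 0 < v (io c) by rewrite absval_gt0 fmorph_eq0; exact: c_neq0.
have XB x y : v (io (X x) - io (X y)) = v (io c) * v (io (x - y)).
  rewrite -(rmorphB io) num_coordB (rmorphM io) (rmorph_nat io).
  by rewrite (absval_2M hp p_gt2 ext_q01) (rmorphM io) absvalM.
split=> [min t tT k|dL x O O0 oO].
  have [[y|] <-] := fix_coord_surj tT; last first.
    by exists 0%N; rewrite expr0 subrr absval0 exprn_ge0 ?absval_ge0.
  have e0 : 0 < q ^+ k * v s / v (io c) by rewrite !(divr_gt0, mulr_gt0, exprn_gt0).
  (* Balls of Q_p have rational radii, so a rational number below the wanted real radius is
     taken. *)
  have [e] := rat_in_itvoo e0; rewrite in_itv /= => /andP[e_gt0 e_lt].
  rewrite ltr0q in e_gt0.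
  have [z yz [n _ nz]] := padic_P1_dense_near y (min None) e_gt0.
  exists n; have := fix_coord_iter n None; rewrite nz /= mulr1 => <-.
  apply: le_trans (absval_cayleyB_le hp p_gt2 ext_q01 ext_sqrt Delta_nsqr s2 _ _) _.
  rewrite XB ler_pdivrMr// mulrC -ler_pdivlMr//; apply: ltW; apply: lt_trans e_lt.
  by rewrite ext_absvalE ltr_rat absvalBC.
have [y [e e0 eO]] := padic_P1_open_ball oO O0.
pose t := fix_coord (Some y) / fix_coord x.
have xT := fix_coord_norm1 x.
have tT : norm1 io s t.
  apply: (norm1M hp p_gt2 ext_q01 ext_sqrt Delta_nsqr s2).
    exact: fix_coord_norm1.
  exact: (norm1V hp p_gt2 ext_q01 ext_sqrt Delta_nsqr s2).
have vx : v (fix_coord x) = 1.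
  exact: (norm1_absval hp p_gt2 ext_q01 ext_sqrt Delta_nsqr s2).
set Y := v (io (X y) - s).
have YE := absval_subsqrt hp p_gt2 ext_q01 ext_sqrt Delta_nsqr s2 (X y).
have Y0 : 0 < Y by rewrite /Y YE lt_max sg orbT.
(* The first bound keeps the iterate away from infinity and permits the converse estimate; the
   second makes that estimate yield a distance below [e]. *)
have eps0 : 0 < Num.min (v s / Y) (ratr e * v (io c) / (Y ^+ 2 / v s)).
  rewrite lt_min divr_gt0//= divr_gt0//; last by rewrite divr_gt0// exprn_gt0.
  by rewrite mulr_gt0// ltr0q.
have [k qk] := ext_qX_lt eps0.
have [n tn] := dL t tT k.
have near : v (fix_coord (iter n (homography a b c d) x) - fix_coord (Some y)) <
    Num.min (v s / Y) (ratr e * v (io c) / (Y ^+ 2 / v s)).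
  rewrite fix_coord_iter; apply: le_lt_trans qk; apply: le_trans tn.
  have -> : fix_coord (Some y) = t * fix_coord x.
    by rewrite /t divfK// -(absval_gt0 v) vx.
  by rewrite -mulrBl absvalM vx mulr1.
exists (iter n (homography a b c d) x); split; last by exists n.
move: near; rewrite lt_min => /andP[].
case: (iter n _ x) => [z|] /=.
  move=> n1 n2; apply: eO.
  have := absval_cayleyB_ge hp p_gt2 ext_q01 ext_sqrt Delta_nsqr s2 n1.
  rewrite XB -/Y => zy.
  have Ys0 : 0 < Y ^+ 2 / v s by rewrite divr_gt0// exprn_gt0.
  rewrite -(@ltr_rat R) -ext_absvalE rmorphB -absvalBC -rmorphB.
  rewrite -(ltr_pM2l vc0); apply: le_lt_trans zy _.
  by rewrite mulrC -ltr_pdivlMl// mulrC [v _ * ratr _]mulrC.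
(* The iterate is not infinity, whose coordinate 1 is at distance exactly [v s / Y]. *)
rewrite absvalBC (absval_cayleyB1 hp p_gt2 ext_q01 ext_sqrt Delta_nsqr s2) -YE.
by rewrite ltxx.
Qed.

End Conjugacy.

(** * Logarithmic valuations and quadratic bases *)

(** Logarithms turn a condition on [vp] (with [e = 1]) or [vpi] into an equality of absolute values;
    [y != 0] avoids the dummy value. *)
Lemma vp_eqE (R : realType) (p : nat) (hp : prime p) (K : fieldExtType (padic hp))
    (v : absval R K) (e n : nat) (y : K) : v p%:R = p%:R^-1 -> y != 0 ->
  (e%:R * vp v y == n%:R) = (v y ^+ e == v p%:R ^+ n).
Proof.
move=> vpE y0.
have p_gt0 : 0 < p%:R :> R by rewrite ltr0n prime_gt0.
have lnp : 0 < ln p%:R :> R by rewrite ln_gt0// ltr1n prime_gt1.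
have vy0 : 0 < v y by rewrite absval_gt0.
have q0 : 0 < v p%:R by rewrite vpE invr_gt0.
have -> : (v y ^+ e == v p%:R ^+ n) = (ln (v y ^+ e) == ln (v p%:R ^+ n)).
  by apply/eqP/eqP => [->//|]; apply: ln_inj; rewrite posrE exprn_gt0.
rewrite !lnXn// vpE lnV ?posrE// /vp mulNrn -[ln (v y) *+ e]mulr_natl.
rewrite -[ln p%:R *+ n]mulr_natl.
have B0 := lt0r_neq0 lnp; move: (ln (v y)) (ln p%:R) B0 => A B B0.
apply/eqP/eqP => E.
  have -> : e%:R * A = - (e%:R * - (A / B)) * B by rewrite !mulrN opprK -mulrA divfK.
  by rewrite E mulNr.
have -> : e%:R * - (A / B) = - (e%:R * A) / B by rewrite mulrN mulrA mulNr.
by rewrite E opprK mulfK.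
Qed.

Section QuadraticBasis.
Context (Q : fieldType) (K : fieldExtType Q) (Delta : Q).
Context (Delta_nsqr : ~ exists x : Q, x ^+ 2 = Delta).
Context (s : K) (s2 : s ^+ 2 = Delta%:A) (K_gen : <<1%VS; s>>%VS = fullv).

(** The minimal polynomial divides [X ^ 2 - Delta], and degree 1 would put [s] in the base field. *)
Lemma adjoin_degree_sqrt : adjoin_degree 1%AS s = 2%N.
Proof.
have sN : s \notin 1%VS.
  apply/negP => /vlineP[k sE]; apply: Delta_nsqr; exists k.
  by apply: (fmorph_inj (in_alg K)); rewrite rmorphXn /= -sE s2.
have ov : 'X^2 - (Delta%:A)%:P \is a polyOver (1%VS : {vspace K}).
  by rewrite rpredB ?rpredX ?polyOverX// polyOverC memvZ ?mem1v.
have rt : root ('X^2 - (Delta%:A)%:P) s.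
  by rewrite /root !hornerE s2 subrr.
have := dvdp_leq _ (minPoly_dvdp ov rt).
rewrite size_minPoly size_XnsubC// => /(_ (monic_neq0 (monicXnsubC _ _))).
move=> /(_ isT) d2.
have := adjoin_deg_eq1 1%AS s; rewrite (negbTE sN).
have : (0 < adjoin_degree 1%AS s)%N by [].
by case: (adjoin_degree _ _) d2 => [|[|[|]]].
Qed.

Lemma dim_quadratic : \dim (fullv : {vspace K}) = 2%N.
Proof. by rewrite -K_gen dim_Fadjoin adjoin_degree_sqrt dimv1. Qed.

Lemma quadratic_coord (z : K) : exists x y : Q, z = x%:A + y%:A * s.
Proof.
have zE : z \in <<1%AS; s>>%VS by rewrite K_gen memvf.
have := Fadjoin_poly_eq zE.
have := size_Fadjoin_poly 1%AS s z; rewrite adjoin_degree_sqrt => sz.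
have /polyOverP coef := Fadjoin_polyOver 1%AS s z.
have /vlineP[x xE] := coef 0%N; have /vlineP[y yE] := coef 1%N.
rewrite (horner_coef_wide s sz) big_ord_recl big_ord1 /= xE yE.
by move=> <-; exists x, y; rewrite expr0 mulr1 expr1.
Qed.

End QuadraticBasis.

(** * Assembly of the two cases *)

Theorem corollary5p5 (R : realType) (p : nat) (hp : prime p) (p_ge3 : (3 <= p)%N)
    (a b c d : padic hp) (abcd : a * d - b * c != 0)
    (Delta : padic hp) (DeltaE : Delta = (d - a) ^+ 2 + 4%:R * b * c)
    (Delta_nsqr : ~ exists x : padic hp, x ^+ 2 = Delta)
    (* K = Q_p(s), with s a square root of Delta *)
    (K : fieldExtType (padic hp)) (s : K) (s2 : s ^+ 2 = Delta%:A)
    (K_gen : <<1%VS; s>>%VS = fullv)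
    (v : absval R K) (v_ext : extends_padic v)
    (pi : K) (pi_unif : uniformizer v pi)
    (e : nat) (e_ram : ramification_index v pi e)
    (lambda : K)
    (lambdaE : lambda = ((a + d)%:A + s) / ((a + d)%:A - s))
    (lambda_nroot : forall n : nat, (0 < n)%N -> lambda ^+ n != 1)
    (l : nat) (l_order : l.-primitive_root (residue v lambda)) :
  minimal (homography a b c d) <->
    [/\ unramified_quadratic K e, l = p.+1 & vp v (lambda ^+ l - 1) = 1] \/
    (ramified_quadratic K e /\ vpi v e (lambda ^+ p + 1) = 3%:R).
Proof.
have p_gt2 : (2 < p)%N := p_ge3.
have [io ioE] : exists io : {rmorphism padic hp -> K}, forall x, io x = x%:A.
  by exists (in_alg K).
have ext x : v (io x) = ratr (padic_absval hp x) by rewrite ioE.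
rewrite -ioE in s2; rewrite -ioE in lambdaE.
have coord z : exists x y, z = io x + io y * s.
  rewrite ioE in s2.
  have [x [y ->]] := quadratic_coord Delta_nsqr s2 K_gen z.
  by exists x, y; rewrite !ioE.
have dimK : \dim (fullv : {vspace K}) = 2%N.
  by rewrite ioE in s2; exact: (dim_quadratic Delta_nsqr s2 K_gen).
have qE := ext_absval_prime ext.
have q01 := ext_q01 ext.
have ioval := ext_val ext.
have ionear := ext_near ext.
have iosqrt := ext_sqrt p_gt2 ext.
have {}lambdaE : lambda = cayley io s (a + d) by [].
have LT : norm1 io s lambda by right; exists (a + d).
rewrite (minimal_homography p_gt2 DeltaE Delta_nsqr s2 ext) -lambdaE.
have [r [i [vs qr r1 rE]]] := sqrt_level hp p_gt2 q01 ioval Delta_nsqr s2.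
have [/andP[_ pi1] pimax] := pi_unif.
have piE : v pi = r.
  exact: (uniformizer_level hp p_gt2 q01 ioval iosqrt Delta_nsqr s2 vs qr r1 coord pi1 pimax).
have r0 : 0 < r by case/andP: q01 => q0 _; apply: lt_le_trans qr.
have eE : v p%:R = r ^+ e by rewrite -piE -absvalX.
have inj := ieexprIn r0 (negbT (lt_eqF r1)).
have Ll0 n : (0 < n)%N -> lambda ^+ n - 1 != 0.
  by move=> n0; rewrite subr_eq0 lambda_nroot.
(* Since [v p = r ^ e], the alternative for [r] fixes [e] as 1 or 2 and thereby rules out the other
   condition. *)
case: rE => rE.
  have e1 : e = 1%N by apply: inj; rewrite -eE expr1 rE.
  rewrite rE in vs.
  rewrite (powers_dense_unramified hp p_gt2 q01 ioval ionear iosqrt Delta_nsqr s2 vs LT l_order).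
  have vpE : (vp v (lambda ^+ l - 1) = 1) <-> (v (lambda ^+ l - 1) = v p%:R).
    have := vp_eqE 1 1 qE (Ll0 l (prim_order_gt0 l_order)).
    by rewrite mul1r !expr1 => E; split=> /eqP H; apply/eqP; rewrite ?E // -?E.
  split=> [[lp Ll]|[[_ lp /vpE Ll]//|[[_]]]]; last by rewrite e1.
  by left; split=> //; apply/vpE.
have e2 : e = 2%N by apply: inj; rewrite -eE rE.
rewrite (powers_dense_ramified hp p_gt2 q01 ioval ionear iosqrt Delta_nsqr s2 vs r0 rE LT).
(* Otherwise [lambda ^ (2 p) = 1], against the assumption on roots of unity. *)
have Lp0 : lambda ^+ p + 1 != 0.
  apply: contra_neq (Ll0 (p * 2)%N _) => [Lp|]; last by rewrite muln_gt0 prime_gt0.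
  by rewrite exprM -[1](expr1n _ 2) subr_sqr Lp mulr0.
have vpiE : (vpi v e (lambda ^+ p + 1) = 3%:R) <-> (v (lambda ^+ p + 1) = r ^+ 3).
  (* With [e = 2] and [q = r ^ 2] the criterion compares the squares of [v (lambda ^ p + 1)] and
     [r ^ 3]. *)
  have := vp_eqE e 3 qE Lp0; rewrite -/(vpi v e _) e2 -rE -exprM mulnC exprM => E.
  have E2 : (v (lambda ^+ p + 1) ^+ 2 == (r ^+ 3) ^+ 2) = (v (lambda ^+ p + 1) == r ^+ 3).
    by rewrite eqrXn2// ?absval_ge0 ?exprn_ge0 ?ltW.
  by rewrite E2 in E; split=> /eqP H; apply/eqP; rewrite ?E // -?E.
split=> [Lp|[[[_ e1] _ _]|[_ /vpiE//]]]; last by rewrite e2 in e1.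
by right; split; [split=> //; rewrite e2|apply/vpiE].
Qed.
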